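(* Let $1<p<\infty$ and $0<s<1$ with $s<1/p$. For $N\ge1$ let $$F=\left[-\tfrac14,\tfrac14\right]^{N-1}\times\{0\}\subset\mathbb{R}^N,\qquad \mathbb{Z}^N_n=\Big\{z\in\mathbb{Z}^N:\max\{|z_1|,\dots,|z_N|\}\le n\Big\},$$ $$\widetilde\Omega_n=\left(-n-\tfrac12,n+\tfrac12\right)^N\setminus\bigcup_{z\in\mathbb{Z}^N_n}(F+z),\qquad n\in\mathbb{N}$$ (for $N=1$, $F=\{0\}$). Then there is a constant $C=C(N,p,F)>0$ such that $$\lambda^1_{p}(\widetilde\Omega_n)\ge C\qquad\text{for every }n\in\mathbb{N},$$ and $$\lim_{n\to\infty}\lambda^s_{p}(\widetilde\Omega_n)=0.$$ In particular, the rescaled sets $$\Omega_n=|\widetilde\Omega_n|^{-\frac1N}\,\widetilde\Omega_n=\left(-\tfrac12,\tfrac12\right)^N\setminus\bigcup_{z\in\mathbb{Z}^N_n}\frac{F+z}{2n+1}$$ satisfy $\mathrm{diam}(\Omega_n)=\sqrt N$ for every $n\in\mathbb{N}$ and $$\lim_{n\to\infty}\frac{\big(\lambda^1_{p}(\Omega_n)\big)^s}{\lambda^s_{p}(\Omega_n)}=+\infty.$$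
   Context: $|A|$ denotes $N$-dimensional Lebesgue measure. $C^\infty_0(\Omega)$ is the space of smooth functions with compact support in the open set $\Omega\subset\mathbb{R}^N$ (extended by $0$ to $\mathbb{R}^N$). The sharp Poincaré constants are $$\lambda^1_p(\Omega)=\inf_{u\in C^\infty_0(\Omega)}\Big\{\|\nabla u\|^p_{L^p(\Omega)}:\|u\|_{L^p(\Omega)}=1\Big\},\qquad \lambda^s_p(\Omega)=\inf_{u\in C^\infty_0(\Omega)}\Big\{[u]^p_{W^{s,p}(\mathbb{R}^N)}:\|u\|_{L^p(\Omega)}=1\Big\},$$ where $$[u]_{W^{s,p}(\mathbb{R}^N)}=\left(\iint_{\mathbb{R}^N\times\mathbb{R}^N}\frac{|u(x)-u(y)|^p}{|x-y|^{N+sp}}\,dx\,dy\right)^{1/p}.$$ *)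

(* Defs.v *)
From HB Require Import structures.
From mathcomp Require Import all_boot all_order all_algebra.
From mathcomp Require Import all_classical all_reals all_analysis.

Set Implicit Arguments.
Unset Strict Implicit.
Unset Printing Implicit Defensive.

Import Order.TTheory GRing.Theory Num.Theory.
Import numFieldNormedType.Exports.

Local Open Scope classical_set_scope.
Local Open Scope ring_scope.

Section rV_measurable.
Context (R : realType) (n : nat).

Let coor (i : 'I_n) (x : 'rV[R]_n) : R := x ord0 i.

Let rV_measurable0 : g_sigma_preimage coor set0.
Proof. exact: sigma_algebra0. Qed.

Let rV_measurableC A :
  g_sigma_preimage coor A -> g_sigma_preimage coor (~` A).
Proof. exact: sigma_algebraC. Qed.

Let rV_bigcup_measurable (F : (set 'rV[R]_n)^nat) :
  (forall i, g_sigma_preimage coor (F i)) ->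
  g_sigma_preimage coor (\bigcup_i F i).
Proof. exact: sigma_algebra_bigcup. Qed.

(* Generated by the coordinates: this is the Borel sigma-algebra of R^n. *)
HB.instance Definition _ := @isMeasurable.Build default_measure_display
  'rV[R]_n (g_sigma_preimage coor)
  rV_measurable0 rV_measurableC rV_bigcup_measurable.

Lemma measurable_coor (i : 'I_n) :
  measurable_fun [set: 'rV[R]_n] (fun x : 'rV[R]_n => x ord0 i).
Proof.
move=> _ Y mY; rewrite setTI; apply: sub_sigma_algebra => /=.
rewrite -bigcup_seq/=; exists i => /=; first by rewrite mem_index_enum.
by exists Y => //; rewrite setTI.
Qed.

Lemma measurable_fun_coorP d (T : measurableType d) (f : T -> 'rV[R]_n) :
  (forall i, measurable_fun [set: T] (fun t => f t ord0 i)) ->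
  measurable_fun [set: T] f.
Proof.
move=> mf; suff H : g_sigma_preimage (fun i t => coor i (f t)) `<=`
    @measurable _ T.
  move=> _ Y mY; rewrite setTI; apply: H.
  by rewrite g_sigma_preimage_comp; exists Y => //; rewrite setTI.
apply: smallest_sub; first exact: sigma_algebra_measurable.
rewrite -bigcup_seq; apply: bigcup_sub => i _ A [B mB <-]; exact: mf.
Qed.

End rV_measurable.

Section lebesgue_step.
Context (R : realType) (n : nat).

Definition rV_cons (z : measurableTypeR R * 'rV[R]_n) : 'rV[R]_n.+1 :=
  row_mx (const_mx z.1 : 'rV[R]_1) z.2.

Lemma measurable_rV_cons : measurable_fun setT rV_cons.
Proof.
apply: measurable_fun_coorP => i.
case: (split_ordP (i : 'I_(1 + n))) => j ->.
  rewrite (_ : (fun t => _) = fst)//.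
  by apply/funext => t; rewrite /rV_cons (row_mxEl _ _ ord0 j) mxE.
rewrite (_ : (fun t => _) = (fun x : 'rV[R]_n => x ord0 j) \o snd); last first.
  by apply/funext => t; exact: (row_mxEr _ t.2 ord0 j).
exact: (measurableT_comp (measurable_coor _) measurable_snd).
Qed.

HB.instance Definition _ := isMeasurableFun.Build _ _ _ _ rV_cons
  measurable_rV_cons.

Variable mu : {sigma_finite_measure set 'rV[R]_n -> \bar R}.

Definition lebesgue_step : set 'rV[R]_n.+1 -> \bar R :=
  pushforward (lebesgue_measure \x mu)%E rV_cons.


Let lebesgue_step0 : lebesgue_step set0 = 0%E.
Proof. exact: measure0. Qed.

Let lebesgue_step_ge0 A : (0 <= lebesgue_step A)%E.
Proof. exact: measure_ge0. Qed.

Let lebesgue_step_sigma_additive : semi_sigma_additive lebesgue_step.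
Proof. exact: measure_semi_sigma_additive. Qed.

HB.instance Definition _ := isMeasure.Build _ _ _ lebesgue_step
  lebesgue_step0 lebesgue_step_ge0 lebesgue_step_sigma_additive.

Let lebesgue_step_sigma_finite : sigma_finite setT lebesgue_step.
Proof.
have /sigma_finiteP[F [FT Fnd mF]] :=
  sigma_finiteT (@lebesgue_measure R : {sigma_finite_measure set _ -> \bar R}).
have /sigma_finiteP[G [GT Gnd mG]] := sigma_finiteT mu.
pose uncons (x : 'rV[R]_(1 + n)) : measurableTypeR R * 'rV[R]_n :=
  (x ord0 ord0, rsubmx x).
have consK : cancel rV_cons uncons.
  move=> [a y]; rewrite /uncons /rV_cons row_mxKr; congr pair.
  have -> : (ord0 : 'I_(1 + n)) = lshift n ord0 by apply/val_inj.
  by rewrite (row_mxEl _ _ ord0 ord0) mxE.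
have munc : measurable_fun setT uncons.
  apply/measurable_fun_pairP; split; first exact: measurable_coor.
  apply: measurable_fun_coorP => i /=.
  rewrite (_ : (fun t => _) = (fun x : 'rV[R]_n.+1 => x ord0 (rshift 1 i))).
    exact: measurable_coor.
  by apply/funext => t; rewrite /uncons /= !mxE.
exists (fun k => uncons @^-1` (F k `*` G k)).
  apply/esym; rewrite -subTset => x _.
  have : [set: measurableTypeR R] (uncons x).1 by [].
  rewrite FT => -[i _ Fi].
  have : [set: 'rV[R]_n] (uncons x).2 by [].
  rewrite GT => -[j _ Gj].
  exists (maxn i j) => //; split.
    by move/subsetPset: (Fnd _ _ (leq_maxl i j)); exact.
  by move/subsetPset: (Gnd _ _ (leq_maxr i j)); exact.
move=> k; have [mFk Fk] := mF k; have [mGk Gk] := mG k; split.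
  by rewrite -[X in measurable X]setTI; apply: munc => //; exact: measurableX.
rewrite /lebesgue_step /pushforward.
rewrite (_ : _ @^-1` _ = F k `*` G k); last first.
  by apply/funext => z; rewrite /preimage /mkset consK.
by rewrite product_measure1E//= lte_mul_pinfty// ge0_fin_numE.
Qed.

HB.instance Definition _ := Measure_isSigmaFinite.Build _ _ _ lebesgue_step
  lebesgue_step_sigma_finite.

End lebesgue_step.

Fixpoint lebesgue_rV (R : realType) (n : nat) :
    {sigma_finite_measure set 'rV[R]_n -> \bar R} :=
  if n is n'.+1 then lebesgue_step (lebesgue_rV R n') else \d_(0 : 'rV[R]_0).

Section euclidean.
Context (R : realType) (N : nat).
Implicit Types (x : 'rV[R]_N) (u : 'rV[R]_N -> R) (A : set 'rV[R]_N).

(* The library norm on 'rV[R]_N is the sup norm; the Euclidean one is needed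
   for the gradient, the fractional kernel and the diameter. *)
Definition enorm x : R := Num.sqrt (\sum_(i < N) x ord0 i ^+ 2).

Definition diam A : \bar R :=
  ereal_sup [set (enorm (x - y))%:E | x in A & y in A].

Definition partial (i : 'I_N) u : 'rV[R]_N -> R := 'D_(delta_mx ord0 i) u.

Definition partials (l : seq 'I_N) u : 'rV[R]_N -> R := foldr partial u l.

Definition grad u x : 'rV[R]_N := \row_(i < N) partial i u x.

Definition smooth u : Prop := forall l : seq 'I_N,
  continuous (partials l u) /\
  forall i x, derivable (partials l u) x (delta_mx ord0 i).

Definition supp u : set 'rV[R]_N := closure [set x | u x != 0].

(* Functions are total on R^N: "extended by 0" outside Omega is forced by the
   condition on the support. *)
Definition Cc_smooth (Omega : set 'rV[R]_N) : set ('rV[R]_N -> R) :=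
  [set u | [/\ smooth u, compact (supp u) & supp u `<=` Omega]].

Definition Lp_norm (Omega : set 'rV[R]_N) (p : R) u : \bar R :=
  'N[lebesgue_rV R N]_p%:E[EFin \o (u \_ Omega)].

(* On the diagonal, a null set for N >= 1, the integrand is 0 / 0 = 0. *)
Definition gagliardo (s p : R) u : \bar R :=
  ((\int[lebesgue_rV R N \x lebesgue_rV R N]_z
     (`|u z.1 - u z.2| `^ p / enorm (z.1 - z.2) `^ (N%:R + s * p))%:E)
   `^ p^-1)%E.

Definition lambda1 (p : R) (Omega : set 'rV[R]_N) : \bar R :=
  ereal_inf [set (Lp_norm Omega p (fun x => enorm (grad u x)) `^ p)%E |
    u in [set u | Cc_smooth Omega u /\ Lp_norm Omega p u = 1%E]].

Definition lambdas (s p : R) (Omega : set 'rV[R]_N) : \bar R :=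
  ereal_inf [set (gagliardo s p u `^ p)%E |
    u in [set u | Cc_smooth Omega u /\ Lp_norm Omega p u = 1%E]].

End euclidean.

Section perforated_cubes.
Context (R : realType) (N : nat).

Definition cube (r : R) : set 'rV[R]_N :=
  [set x | forall i, - r < x ord0 i < r].

(* [-1/4, 1/4]^(N-1) x {0}: the index i with i.+1 == N is the last one. *)
Definition slit : set 'rV[R]_N :=
  [set x | forall i : 'I_N,
    if i.+1 == N then x ord0 i = 0 else - (1 / 4) <= x ord0 i <= 1 / 4].

Definition Zbox (n : nat) : set 'rV[int]_N :=
  [set z | (\max_(i < N) `|z ord0 i| <= n)%N].

Definition slit_at (z : 'rV[int]_N) : set 'rV[R]_N :=
  [set x + map_mx intr z | x in slit].

Definition Omega_tilde (n : nat) : set 'rV[R]_N :=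
  cube (n%:R + 1 / 2) `\` \bigcup_(z in Zbox n) slit_at z.

Definition dilate (c : R) (A : set 'rV[R]_N) : set 'rV[R]_N :=
  [set c *: x | x in A].

Definition Omega (n : nat) : set 'rV[R]_N :=
  dilate (fine (lebesgue_rV R N (Omega_tilde n)) `^ (- (1 / N%:R)))
    (Omega_tilde n).

End perforated_cubes.

Arguments cube {R N} r.
Arguments slit {R N}.
Arguments Zbox {N} n.
Arguments slit_at {R N} z.
Arguments dilate {R N} c A.
Arguments Omega_tilde R N n : clear implicits.
Arguments Omega R N n : clear implicits.

(* Main.v *)
(* Lower bound for lambda^1: over the window tube 0 (all coordinates but the last within
   1/4 of an integer) every line in the last direction meets a slit at distance at
   most 1/2, so a test function is controlled there by its gradient along the line.
   Translating by 1/2 in one coordinate sends the gaps of that coordinate into its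
   window, and doing so once per coordinate covers the whole space at the cost of a
   factor depending on p and N only.
   Upper bound for lambda^s: the slits lie in 2n+1 hyperplanes, and since s p < 1 cutting a
   slab of width eps out of a cutoff at scale r costs at most C eps^(1 - s p) r^(N-1)
   of Gagliardo energy. For eps small enough the 2n+1 slabs contribute no more than
   the cutoff itself, so that lambda^s <= C r^(-s p) with r = n + 1/2. *)

From HB Require Import structures.
Require Import Defs.
From mathcomp Require Import all_boot all_order all_algebra.
From mathcomp Require Import all_classical all_reals all_analysis.
From mathcomp Require Import measurable_realfun ring lra zify.

Set Implicit Arguments.
Unset Strict Implicit.
Unset Printing Implicit Defensive.

Import Order.TTheory GRing.Theory Num.Theory.
Import numFieldNormedType.Exports.

Local Open Scope classical_set_scope.
Local Open Scope ring_scope.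

(** * Integration on row vectors *)

(** The lower bound sees only the spacing [l] of the slits and is a constant times l^(-p); the upper
    bound sees only the outer half-side r. For l = 1 / (2n+1) one has r = 1/2 for all n, so after
    rescaling the fractional constant stays bounded while the local one grows at least like n^p.
    Lines through the gaps between slits meet no slit at all; this is why the lower bound cannot be
    obtained line by line and needs the translations. For the upper bound the slits may be replaced
    by full hyperplanes: a slab of relative width [eta] costs eta^(1 - s p), and [eta] is about
    (2n+1)^(-1/(1 - s p)), which exists exactly because s p < 1. The ratio in the last claim is
    formed from real numbers extracted by [fine], so two qualitative facts are needed besides the
    bounds: the local constant is finite and the fractional one is positive. *)

Section integration_rV.
Context (R : realType).
Local Notation mu := lebesgue_measure.
Local Notation leb n := (lebesgue_rV R n).

Lemma rV_consE0 n a (y : 'rV[R]_n) : rV_cons (a, y) ord0 ord0 = a.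
Proof.
rewrite /rV_cons /=.
have -> : (ord0 : 'I_(1 + n)) = lshift n ord0 by apply/val_inj.
by apply: (etrans (row_mxEl _ _ ord0 ord0)); rewrite mxE.
Qed.

Lemma rV_consES n a (y : 'rV[R]_n) i : rV_cons (a, y) ord0 (lift ord0 i) = y ord0 i.
Proof.
rewrite /rV_cons /=.
have -> : (lift ord0 i : 'I_(1 + n)) = rshift 1 i by apply/val_inj.
exact: (row_mxEr _ _ ord0 i).
Qed.

Lemma rV_consP n (x : 'rV[R]_n.+1) :
  x = rV_cons (x ord0 ord0, \row_i x ord0 (lift ord0 i)).
Proof.
apply/rowP => i; case: (unliftP ord0 i) => [j|] ->.
  by rewrite rV_consES mxE.
by rewrite rV_consE0.
Qed.

Lemma measurable_comp_rV_cons n (f : 'rV[R]_n.+1 -> \bar R) :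
  measurable_fun setT f -> measurable_fun setT (f \o @rV_cons R n).
Proof. move=> mf; exact: (measurableT_comp mf (@measurable_rV_cons R n)). Qed.

Lemma ge0_integral_rVS n (f : 'rV[R]_n.+1 -> \bar R) :
  measurable_fun setT f -> (forall x, (0 <= f x)%E) ->
  (\int[leb n.+1]_x f x = \int[mu]_a \int[leb n]_y f (rV_cons (a, y)))%E.
Proof.
move=> mf f0.
rewrite /= (ge0_integral_pushforward (@measurable_rV_cons R n)) //.
rewrite preimage_setT (fubini_tonelli1 (f \o @rV_cons R n)) //.
  exact: measurable_comp_rV_cons.
by move=> x; exact: f0.
Qed.

Lemma ge0_integral_rVS_swap n (f : 'rV[R]_n.+1 -> \bar R) :
  measurable_fun setT f -> (forall x, (0 <= f x)%E) ->
  (\int[leb n.+1]_x f x = \int[leb n]_y \int[mu]_a f (rV_cons (a, y)))%E.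
Proof.
move=> mf f0; rewrite ge0_integral_rVS//.
apply: (fubini_tonelli (f \o @rV_cons R n)) => //.
  exact: measurable_comp_rV_cons.
by move=> x; exact: f0.
Qed.

Definition shiftR (v : R) (x : measurableTypeR R) : measurableTypeR R := (x + v)%R.

Lemma measurable_shiftR v : measurable_fun setT (shiftR v).
Proof. exact: measurable_funD. Qed.

HB.instance Definition _ v := isMeasurableFun.Build _ _ _ _ (shiftR v)
  (measurable_shiftR v).

(** The pushforward under a translation gives every []a, b]] its length, and Lebesgue measure is the
    only measure that does. *)
Lemma lebesgue_measure_shift (v : R) (A : set R) : measurable A ->
  mu (( +%R^~ v) @^-1` A) = mu A.
Proof.
move=> mA.
transitivity (pushforward mu (shiftR v) A); first by [].
apply/esym; apply: lebesgue_measure_unique => //= _ [[a b]] _ <-.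
rewrite /pushforward /=.
rewrite (_ : _ @^-1` _ = `]a - v, b - v]%classic).
  rewrite !lebesgue_measure_itv/= !lte_fin ltrD2r.
  by case: ifPn => // _; rewrite -!EFinB; congr EFin; ring.
by apply/seteqP; split => x; rewrite /= !in_itv/= ltrBlDr lerBrDr.
Qed.

Lemma ge0_integral_shift (f : R -> \bar R) v : measurable_fun setT f ->
  (forall x, (0 <= f x)%E) -> (\int[mu]_x f (x + v)%R = \int[mu]_x f x)%E.
Proof.
move=> mf f0.
transitivity (\int[pushforward mu (shiftR v)]_y f y)%E.
  by rewrite ge0_integral_pushforward.
by apply: eq_measure_integral => A mA _; exact: lebesgue_measure_shift.
Qed.

Lemma measurable_shift_rV n (v : 'rV[R]_n) :
  measurable_fun setT (fun x : 'rV[R]_n => x + v).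
Proof.
apply: measurable_fun_coorP => i.
under eq_fun do rewrite mxE.
apply: measurable_funD => //; exact: measurable_coor.
Qed.

(** Induction on the dimension: after Tonelli the inner integral absorbs the first coordinate of
    [v], and the induction hypothesis for the partial integral [G] absorbs the others. *)
Lemma ge0_integral_shift_rV n (f : 'rV[R]_n -> \bar R) v : measurable_fun setT f ->
  (forall x, (0 <= f x)%E) -> (\int[leb n]_x f (x + v)%R = \int[leb n]_x f x)%E.
Proof.
elim: n f v => [|n IH] f v mf f0.
  by apply: eq_integral => x _; rewrite [x + v]thinmx0 [x in RHS]thinmx0.
have mfv : measurable_fun setT (fun x : 'rV[R]_n.+1 => f (x + v)).
  exact: measurableT_comp mf (measurable_shift_rV v).
have -> := ge0_integral_rVS_swap mf f0.
have -> := ge0_integral_rVS_swap mfv (fun x => f0 _).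
pose w : 'rV[R]_n := \row_i v ord0 (lift ord0 i).
pose G (y : 'rV[R]_n) := (\int[mu]_a f (rV_cons (a, y)))%E.
have mG : measurable_fun setT G.
  exact: (measurable_fun_fubini_tonelli_G (f \o @rV_cons R n)
    (measurable_comp_rV_cons mf) (fun x => f0 _)).
transitivity (\int[leb n]_y G (y + w)%R)%E; last first.
  by apply: (IH G w mG) => y; exact: integral_ge0.
apply: eq_integral => y _.
pose h (a : R) := f (rV_cons (a, y + w)).
transitivity (\int[mu]_a h (a + v ord0 ord0)%R)%E; last first.
  apply: (@ge0_integral_shift h) => [|x]; last exact: f0.
  exact: (measurableT_comp (measurable_comp_rV_cons mf) (pair2_measurable (y + w))).
apply: eq_integral => a _; congr f.
rewrite [LHS]rV_consP; congr (rV_cons (_, _)).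
  by rewrite mxE rV_consE0.
by apply/rowP => i; rewrite mxE [LHS]mxE rV_consES [RHS]mxE [in RHS]mxE.
Qed.

Definition box n (I : 'I_n -> set R) : set 'rV[R]_n :=
  [set x | forall i, I i (x ord0 i)].

Lemma measurable_box n (I : 'I_n -> set R) :
  (forall i, measurable (I i)) -> measurable (box I).
Proof.
move=> mI.
rewrite (_ : box I = \big[setI/setT]_(i < n) ((fun x : 'rV[R]_n => x ord0 i) @^-1` I i)).
  apply: bigsetI_measurable => i _; rewrite -[X in measurable X]setTI.
  exact: measurable_coor.
apply/seteqP; split => x /=.
  by move=> Hx; rewrite -bigcap_seq => i _ /=; exact: Hx.
rewrite -bigcap_seq => Hx i; apply: Hx => /=; exact: mem_index_enum.
Qed.

Lemma lebesgue_rV_box n (I : 'I_n -> set R) :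
  (forall i, measurable (I i)) -> leb n (box I) = (\prod_(i < n) mu (I i))%E.
Proof.
elim: n I => [|n IH] I mI.
  by rewrite big_ord0 /= diracE mem_set// => -[].
rewrite big_ord_recl -IH; last by move=> i; exact: mI.
rewrite /= /lebesgue_step /pushforward.
rewrite (_ : _ @^-1` _ = I ord0 `*` box (fun i => I (lift ord0 i))).
  by rewrite product_measure1E//; first exact: mI; exact: measurable_box.
apply/seteqP; split => -[a y] /=.
  move=> H; split; first by have := H ord0; rewrite rV_consE0.
  by move=> i; have := H (lift ord0 i); rewrite rV_consES.
move=> [Ha Hy] i; case: (unliftP ord0 i) => [j|] ->; by rewrite ?rV_consES ?rV_consE0.
Qed.

(** The sigma-algebra is generated by coordinates, so open sets must be built from boxes. Balls of
    the sup norm are boxes, and those with rational centre and radius 1/(k+1) are countable in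
    number; the ones inside [U] cover it. *)
Lemma open_measurable_rV n (U : set 'rV[R]_n) : open U -> measurable U.
Proof.
move=> oU.
pose B (q : 'rV[rat]_n * nat) :=
  box (fun i => `]ratr (q.1 ord0 i) - q.2.+1%:R^-1, ratr (q.1 ord0 i) + q.2.+1%:R^-1[%classic : set R).
have mB q : measurable (B q) by apply: measurable_box => i; exact: measurable_itv.
pose D q := if pselect (B q `<=` U) then B q else set0.
have -> : U = \bigcup_(k in [set: nat]) (if unpickle k is Some q then D q else set0).
  apply/seteqP; split => [x Ux|x [k _]]; last first.
    by case: unpickle => [q|//]; rewrite /D; case: pselect => // H /H.
  have /nbhs_ballP[e /= e0 eU] := oU _ Ux.
  (* The centre will lie within 1/(k+1) of [x], so the whole box lies within 2/(k+1) < e of [x]. *)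
  have [k ke] : exists k : nat, k.+1%:R^-1 < e / 2 :> R.
    exists (Num.truncn (e / 2)^-1); rewrite invf_plt ?posrE ?divr_gt0//.
    exact: truncnS_gt.
  have H i : {q : rat | ratr q \in `]x ord0 i - k.+1%:R^-1, x ord0 i + k.+1%:R^-1[}.
    apply: cid; have [|q qH] := @rat_in_itvoo R (x ord0 i - k.+1%:R^-1) (x ord0 i + k.+1%:R^-1).
    rewrite ltrBlDr -addrA ltrDl addr_gt0// invr_gt0.
  by exists q.
  pose q : 'rV[rat]_n := \row_i sval (H i).
  have Dx : D (q, k) x.
    rewrite /D; case: pselect => [_ i /=|].
      rewrite mxE; have := svalP (H i); rewrite !in_itv/= => /andP[h1 h2].
      by rewrite ltrBlDr h2 -ltrBlDr h1.
    case=> y By; apply: eU; rewrite mx_norm_ball in e0 *.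
    rewrite -mx_norm_ball; split => // i0 i; have -> : i0 = ord0 by rewrite [i0]ord1; apply/val_inj.
    have := By i; rewrite /= mxE; have := svalP (H i).
    rewrite !in_itv/=; move: (ratr _ : R) => t /andP[h1 h2] /andP[h3 h4].
    move: (k.+1%:R^-1 : R) ke h1 h2 h3 h4 => d ke h1 h2 h3 h4.
    rewrite /ball/= ltr_norml; apply/andP; split; lra.
  by exists (pickle (q, k)) => //; rewrite pickleK.
apply: bigcup_measurable => k _; case: unpickle => [q|//]; rewrite /D.
by case: pselect => _ /=; [exact: mB|exact: measurable0].
Qed.

Lemma continuous_measurable_rV n (f : 'rV[R]_n -> R) : continuous f ->
  measurable_fun setT f.
Proof.
move=> /continuousP cf; apply: (measurability _ (RGenOpens.measurableE R)).
move=> _ [_ [a [b ->]] <-]; rewrite setTI; apply: open_measurable_rV.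
exact/cf/interval_open.
Qed.

Lemma le_norm_coord n (x : 'rV[R]_n) i : `|x ord0 i| <= `|x|.
Proof.
rewrite [in leRHS]/Num.norm/= mx_normrE.
by apply: (le_bigmax _ (fun ij : 'I_1 * 'I_n => `|x ij.1 ij.2|) (ord0, i)).
Qed.

Lemma norm_rV_le n (x : 'rV[R]_n) r : 0 <= r -> (`|x| <= r) = [forall i, `|x ord0 i| <= r].
Proof.
move=> r0; rewrite [in LHS]/Num.norm/= mx_normrE; apply/bigmax_leP/forallP => /=.
  by move=> [_ H] i; apply: (H (ord0, i)).
by move=> H; split=> // -[i j] _; rewrite [i]ord1.
Qed.

Lemma norm_rV_le_enorm n (x : 'rV[R]_n) : `|x| <= enorm x.
Proof.
rewrite norm_rV_le ?sqrtr_ge0//; apply/forallP => i.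
rewrite -sqrtr_sqr ler_sqrt; last by apply: sumr_ge0 => j _; exact: sqr_ge0.
rewrite (bigD1 i)//= lerDl; apply: sumr_ge0 => j _; exact: sqr_ge0.
Qed.

Lemma enorm_le n (x : 'rV[R]_n) r : 0 <= r -> (forall i, `|x ord0 i| <= r) ->
  enorm x <= Num.sqrt n%:R * r.
Proof.
move=> r0 H; rewrite -[in leRHS](ger0_norm r0) -sqrtr_sqr -sqrtrM ?ler0n//.
rewrite ler_sqrt ?mulr_ge0 ?sqr_ge0//.
rewrite mulr_natl -[in leRHS](card_ord n) -sumr_const; apply: ler_sum => i _.
by rewrite -real_normK ?num_real// lerXn2r ?nnegrE.
Qed.

Lemma measurable_enorm n : measurable_fun setT (@enorm R n).
Proof.
apply: measurableT_comp; first exact: (continuous_measurable_fun (@sqrt_continuous R)).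
apply: measurable_sum => i; apply: measurable_funX; exact: measurable_coor.
Qed.

End integration_rV.

(** * Smooth cutoffs *)

Section flat.
Context (R : realType).

(** A directional derivative is the derivative at 0 along a line, which reduces the claim to the
    chain rule in one variable. *)
Lemma is_derive_comp1 (V : normedModType R) (f : V -> R) (g : R -> R) (x v : V) df dg :
  is_derive x v f df -> is_derive (f x) 1 g dg -> is_derive x v (g \o f) (dg * df).
Proof.
move=> [f1 fE] [g1 gE].
pose h (t : R) := f (t *: v + x).
have h0 : h 0 = f x by rewrite /h scale0r add0r.
have hD : is_derive (0 : R) (1 : R) h df.
  apply: DeriveDef; first exact: (derivable1P f x v).1 f1.
  rewrite -fE /derive; set g1' := (fun h => _); set g2' := (fun h => _).
  suff -> : g1' = g2' by [].
  by rewrite funeqE /g1' /g2' /h => t /=; rewrite !addr0 scale0r add0r [_%:A]mulr1.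
have gD : is_derive (h 0) (1 : R) g dg by rewrite h0; apply: DeriveDef.
have [c1 c2] := is_derive1_comp gD hD.
apply: DeriveDef; first exact: (derivable1P (g \o f) x v).2 c1.
rewrite -c2 /derive; set g1' := (fun h => _); set g2' := (fun h => _).
suff -> : g1' = g2' by [].
by rewrite funeqE /g1' /g2' /h => t /=; rewrite !addr0 scale0r add0r [_%:A]mulr1.
Qed.

(* Closed under derivation: (flat k)' = flat (k+2) - k flat (k+1). *)
Definition flat (k : nat) (x : R) : R :=
  if 0 < x then x^-1 ^+ k * expR (- x^-1) else 0.

Lemma flat_ge0 k x : 0 <= flat k x.
Proof.
by rewrite /flat; case: ifPn => // x0; rewrite mulr_ge0 ?expR_ge0 ?exprn_ge0 ?invr_ge0// ltW.
Qed.

Lemma flat_le0 k x : x <= 0 -> flat k x = 0.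
Proof. by rewrite /flat leNgt => /negbTE ->. Qed.

(** Keep only the term of degree k+m+1 in the exponential series at 1/x: k powers cancel the
    prefactor and m+1 powers of x remain, so [flat k] vanishes at 0 to every order. *)
Lemma flat_bound m k x : 0 <= x -> flat k x <= (k + m).+1`!%:R * x ^+ m.+1.
Proof.
rewrite le_eqVlt => /predU1P[<-|x0].
  by rewrite flat_le0// mulr_ge0 ?exprn_ge0// ler0n.
rewrite /flat x0 expRN.
have t0 : 0 < x^-1 by rewrite invr_gt0.
have H := expR_ge1Dxn (k + m) (ltW t0).
have f0 : 0 < (k + m).+1`!%:R :> R by rewrite ltr0n fact_gt0.
rewrite ler_pdivrMr ?expR_gt0//.
apply: (@le_trans _ _ ((k + m).+1`!%:R * x ^+ m.+1 * (x^-1 ^+ (k + m).+1 / (k + m).+1`!%:R))).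
  set F : R := _.+1`!%:R in f0 *; rewrite -addnS exprD.
  have bc : x ^+ m.+1 * x^-1 ^+ m.+1 = 1 by rewrite -exprMn mulfV ?gt_eqF// expr1n.
  rewrite [leRHS](_ : _ = x^-1 ^+ k * (x ^+ m.+1 * x^-1 ^+ m.+1) * (F / F)); last by ring.
  by rewrite bc divff ?gt_eqF// !mulr1.
rewrite ler_wpM2l ?mulr_ge0 ?exprn_ge0 ?ltW//.
by apply: lt_le_trans H; rewrite ltrDr.
Qed.

Lemma is_derive_flat k (x : R) :
  is_derive x (1 : R) (flat k) (flat k.+2 x - k%:R * flat k.+1 x).
Proof.
have [x0|x0|->] := ltgtP x 0.
- rewrite !flat_le0 ?ltW// mulr0 subr0.
  apply: (@near_eq_is_derive R R R ((fun=> 0) : R -> R)).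
  near=> y; rewrite flat_le0// ltW//; near: y; exact: lt_nbhsl.
- pose g : R -> R := (GRing.inv ^+ k) * (expR \o (- GRing.inv)).
  apply: (@near_eq_is_derive _ _ _ g).
    near=> y; rewrite /flat/g ifT//; first by rewrite /= mulrfctE exprfctE.
    near: y; exact: lt_nbhsr.
  have iV : is_derive x (1 : R) (GRing.inv : R -> R) (- x ^- 2).
    apply: (is_derive_eq (@is_deriveV _ id x 1 1 _ _)); first by rewrite gt_eqF.
    by rewrite [_ *: 1]mulr1.
  have iX := is_deriveX k iV.
  have iE := @is_derive1_comp _ expR (- GRing.inv) x _ _ (is_derive_expR _) (is_deriveN iV).
  apply: (is_derive_eq (is_deriveM iX iE)).
  rewrite /flat x0 exprfctE /GRing.scale/=.
  rewrite opprK -!exprVn [(- GRing.inv) x]/(- x^-1).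
  set a := expR (- x^-1); set b := x^-1.
  case: k {g iX} => [|k]; first by rewrite /=; ring.
  rewrite /= !exprS; ring.
- rewrite !flat_le0// mulr0 subr0.
  have H : (fun h : R => h^-1 *: ((flat k \o shift 0) (h *: (1 : R)) - flat k 0)) @ 0^' --> 0.
    apply/cvgr0Pnorm_lt => e e0.
    have C0 : 0 < (k + 1).+1`!%:R :> R by rewrite ltr0n fact_gt0.
    near=> h.
    rewrite /= (flat_le0 _ (lexx 0)) subr0 addr0 [_%:A]mulr1.
    have h0 : h != 0 by near: h; exact: nbhs_dnbhs_neq.
    have [hn|hp] := leP h 0; first by rewrite flat_le0// scaler0 normr0.
    rewrite ger0_norm; last by rewrite mulr_ge0 ?flat_ge0// invr_ge0 ltW.
    rewrite /GRing.scale/= mulrC ltr_pdivrMr//.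
    (* Vanishing to second order bounds the difference quotient at 0 by a constant times [h]. *)
    apply: le_lt_trans (flat_bound 1 k (ltW hp)) _.
    rewrite expr2 mulrA ltr_pM2r// -ltr_pdivlMl//.
    rewrite -[ltLHS](gtr0_norm hp); near: h.
    apply: dnbhs0_lt; rewrite mulr_gt0 ?invr_gt0//.
  apply: DeriveDef; first by apply/cvg_ex; exists 0.
  exact: cvg_lim H.
Unshelve. all: by end_near. Qed.

Lemma continuous_flat k : continuous (flat k).
Proof.
move=> x; apply/differentiable_continuous/derivable1_diffP.
exact: (@ex_derive _ _ _ _ _ _ _ (is_derive_flat k x)).
Qed.

(** With t = 1/x this is t^2 <= 2 exp t. Since [flat 2] is the derivative of [flat 0], it yields the
    Lipschitz constant 2. *)
Lemma flat2_le x : flat 2 x <= 2.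
Proof.
have [x0|x0] := leP x 0; first by rewrite flat_le0.
rewrite /flat x0; set t := x^-1.
have t0 : 0 < t by rewrite invr_gt0.
have := expR_ge1Dxn 1 (ltW t0); rewrite (_ : 2`! = 2)%N// => H.
rewrite expRN ler_pdivrMr ?expR_gt0//; lra.
Qed.

Lemma flat_lip x y : `|flat 0 x - flat 0 y| <= 2 * `|x - y|.
Proof.
wlog xy : x y / x <= y.
  move=> H; have [xy|/ltW yx] := leP x y; first exact: H.
  by rewrite distrC (distrC x); exact: H.
rewrite distrC (distrC x).
have [||c _ ->] := @MVT_segment R (flat 0) (fun z => flat 2 z - 0%:R * flat 1 z) x y xy.
- by move=> z _; exact: is_derive_flat.
- exact/continuous_subspaceT/continuous_flat.
rewrite mul0r subr0 normrM ler_wpM2r// ger0_norm ?flat_ge0//; exact: flat2_le.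
Qed.

Lemma flat_ge_half x : 2 <= x -> 1 / 2 <= flat 0 x.
Proof.
move=> x2; have x0 : 0 < x by lra.
rewrite /flat x0 expr0 [leRHS]mul1r.
have := expR_ge1Dx (- x^-1); apply: le_trans.
suff : x^-1 <= 2^-1 by lra.
by rewrite lef_pV2 ?posrE.
Qed.

(* [1] on [x <= 0], [0] on [x >= 2] since [flat 0 x >= 1 / 2] there. *)
Definition step (x : R) : R := expR 2 * flat 0 (1 / 2 - flat 0 x).

Lemma expR2_flat : expR 2 * flat 0 (1 / 2) = 1.
Proof.
rewrite /flat divr_gt0// expr0 mul1r div1r invrK -expRD subrr expR0 //.
Qed.

Lemma flat0_le x y : x <= y -> flat 0 x <= flat 0 y.
Proof.
move=> xy; have [x0|x0] := leP x 0; first by rewrite flat_le0// flat_ge0.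
rewrite /flat x0 (lt_le_trans x0 xy) !expr0 !mul1r ler_expR lerN2 lef_pV2//.
by rewrite posrE (lt_le_trans x0 xy).
Qed.

Lemma step_ge0 x : 0 <= step x.
Proof. by rewrite mulr_ge0 ?expR_ge0 ?flat_ge0. Qed.

Lemma step_le1 x : step x <= 1.
Proof.
rewrite -[leRHS]expR2_flat ler_wpM2l ?expR_ge0// flat0_le//.
have := flat_ge0 0 x; lra.
Qed.

Lemma step_le0 x : x <= 0 -> step x = 1.
Proof. by move=> x0; rewrite /step (flat_le0 0 x0) subr0 expR2_flat. Qed.

Lemma step_ge2 x : 2 <= x -> step x = 0.
Proof. by move=> /flat_ge_half x2; rewrite /step flat_le0 ?mulr0//; lra. Qed.

Lemma step_lip x y : `|step x - step y| <= expR 2 * 4 * `|x - y|.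
Proof.
rewrite -mulrBr normrM ger0_norm ?expR_ge0// -!mulrA ler_wpM2l ?expR_ge0//.
apply: le_trans (flat_lip _ _) _; have := flat_lip x y.
rewrite (_ : 1 / 2 - _ - _ = flat 0 y - flat 0 x); last by ring.
rewrite (distrC (flat 0 y)); lra.
Qed.

(* [1] on [|x| <= r], [0] on [|x| >= 3 r]. *)
Definition bump (r x : R) : R := step (x / r - 1) * step (- x / r - 1).

Lemma bump_ge0 r x : 0 <= bump r x.
Proof. by rewrite mulr_ge0// step_ge0. Qed.

Lemma bump_le1 r x : bump r x <= 1.
Proof. by rewrite mulr_ile1// ?step_ge0 ?step_le1. Qed.

Lemma bump_eq1 r x : 0 < r -> `|x| <= r -> bump r x = 1.
Proof.
rewrite ler_norml => r0 /andP[x1 x2].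
by rewrite /bump !step_le0 ?mulr1// subr_le0 ler_pdivrMr// mul1r// lerNl.
Qed.

Lemma bump_eq0 r x : 0 < r -> 3 * r <= `|x| -> bump r x = 0.
Proof.
move=> r0; rewrite /bump; have [x0|x0] := leP 0 x => H.
  rewrite ger0_norm// in H; rewrite step_ge2 ?mul0r// -lerBlDr opprK ler_pdivlMr//; lra.
rewrite ltr0_norm// in H; rewrite [X in _ * X]step_ge2 ?mulr0// -lerBlDr opprK ler_pdivlMr//; lra.
Qed.

(** Each factor is at most 1 with slope at most 4 exp(2) / r, the 4 coming from the two nested
    copies of [flat 0] in [step]; the product rule doubles it. *)
Lemma bump_lip r x y : 0 < r -> `|bump r x - bump r y| <= expR 2 * 8 / r * `|x - y|.
Proof.
move=> r0; rewrite /bump.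
set a := step _; set b := step _; set c := step _; set d := step _.
have h1 : `|b - d| <= expR 2 * 4 * (`|x - y| / r).
  apply: le_trans (step_lip _ _) _; rewrite ler_wpM2l ?mulr_ge0 ?expR_ge0//.
  rewrite (_ : _ - _ = - ((x - y) / r)); last by ring.
  by rewrite normrN normrM [`|r^-1|]gtr0_norm ?invr_gt0.
have h2 : `|a - c| <= expR 2 * 4 * (`|x - y| / r).
  apply: le_trans (step_lip _ _) _; rewrite ler_wpM2l ?mulr_ge0 ?expR_ge0//.
  rewrite (_ : _ - _ = (x - y) / r); last by ring.
  by rewrite normrM [`|r^-1|]gtr0_norm ?invr_gt0.
have h3 : `|a| <= 1 by rewrite ger0_norm ?step_ge0// step_le1.
have h4 : `|d| <= 1 by rewrite ger0_norm ?step_ge0// step_le1.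
clearbody a b c d.
have -> : a * b - c * d = a * (b - d) + (a - c) * d by ring.
apply: le_trans (ler_normD _ _) _; rewrite !normrM.
rewrite (_ : _ * `|x - y| = expR 2 * 4 * (`|x - y| / r) + expR 2 * 4 * (`|x - y| / r)); last by ring.
apply: lerD; rewrite -[leRHS]mul1r; first by rewrite ler_pM.
by rewrite mulrC ler_pM.
Qed.

End flat.

Section smooth_expr.
Context (R : realType) (n : nat).
Implicit Types (f g : 'rV[R]_n -> R) (x : 'rV[R]_n).

(* A class of functions visibly closed under partial derivatives; it is enough
   to build cutoff functions. *)
Inductive smooth_expr : ('rV[R]_n -> R) -> Prop :=
| smooth_expr_cst c : smooth_expr (fun=> c)
| smooth_expr_coord i : smooth_expr (fun x => x ord0 i)
| smooth_exprD f g : smooth_expr f -> smooth_expr g -> smooth_expr (fun x => f x + g x)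
| smooth_exprM f g : smooth_expr f -> smooth_expr g -> smooth_expr (fun x => f x * g x)
| smooth_expr_flat k f : smooth_expr f -> smooth_expr (fun x => flat k (f x)).

Lemma continuous_smooth_expr f : smooth_expr f -> continuous f.
Proof.
elim=> {f} [c|i|f g _ cf _ cg|f g _ cf _ cg|k f _ cf] x.
- exact: cst_continuous.
- exact: coord_continuous.
- exact: (cvgD (cf x) (cg x)).
- exact: (cvgM (cf x) (cg x)).
- exact: (@continuous_comp _ _ _ f (flat k) x (cf x) (continuous_flat (k := k) (x := f x))).
Qed.

Lemma is_derive_coord i j x :
  is_derive x (delta_mx ord0 i) (fun x : 'rV[R]_n => x ord0 j) (i == j)%:R.
Proof.
have H : (fun h : R => h^-1 *: (((fun x : 'rV[R]_n => x ord0 j) \o shift x)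
    (h *: delta_mx ord0 i) - x ord0 j)) @ 0^' --> ((i == j)%:R : R).
  apply: cvg_near_cst; near=> h.
  have h0 : h != 0 by near: h; exact: nbhs_dnbhs_neq.
  rewrite /= !mxE eqxx eq_sym addrK /GRing.scale/= mulrA mulVf// mul1r//.
apply: DeriveDef; first by apply/cvg_ex; exists ((i == j)%:R : R).
exact: cvg_lim H.
Unshelve. all: by end_near. Qed.

Lemma smooth_expr_derive f i : smooth_expr f ->
  exists2 g, smooth_expr g & forall x, is_derive x (delta_mx ord0 i) f (g x).
Proof.
elim=> {f} [c|j|f g sf [df sdf Hf] sg [dg sdg Hg]|f g sf [df sdf Hf] sg [dg sdg Hg]|k f sf [df sdf Hf]].
- exists (fun=> 0); first exact: smooth_expr_cst.
  by move=> x; exact: is_derive_cst.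
- exists (fun=> (i == j)%:R); first exact: smooth_expr_cst.
  by move=> x; exact: is_derive_coord.
- exists (fun x => df x + dg x); first exact: smooth_exprD.
  by move=> x; exact: is_deriveD.
- exists (fun x => f x * dg x + g x * df x).
    by apply: smooth_exprD; exact: smooth_exprM.
  by move=> x; exact: is_deriveM.
- exists (fun x => (flat k.+2 (f x) + (- k%:R) * flat k.+1 (f x)) * df x).
    apply: smooth_exprM => //; apply: smooth_exprD; first exact: smooth_expr_flat.
    by apply: smooth_exprM; [exact: smooth_expr_cst|exact: smooth_expr_flat].
  move=> x; rewrite mulNr; apply: is_derive_comp1; exact: is_derive_flat.
Qed.

Lemma smooth_expr_partial f i : smooth_expr f -> smooth_expr (partial i f).
Proof.
move=> /(smooth_expr_derive i)[g sg Hg]; suff -> : partial i f = g by [].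
by apply/funext => x; exact: (@derive_val _ _ _ _ _ _ _ (Hg x)).
Qed.

Lemma smooth_expr_smooth f : smooth_expr f -> smooth f.
Proof.
move=> sf l; have sl : smooth_expr (partials l f).
  by elim: l => //= i l IH; exact: smooth_expr_partial.
split; first exact: continuous_smooth_expr.
by move=> i x; have [g _ /(_ x)[]] := smooth_expr_derive i sl.
Qed.

Lemma smooth_expr_prod (I : Type) (r : seq I) (P : pred I) (F : I -> 'rV[R]_n -> R) :
  (forall i, smooth_expr (F i)) -> smooth_expr (fun x => \prod_(i <- r | P i) F i x).
Proof.
move=> sF; elim: r => [|i r IH].
  by under eq_fun do rewrite big_nil; exact: smooth_expr_cst.
under eq_fun do rewrite big_cons; case: (P i) => //.
exact: smooth_exprM.
Qed.

Lemma smooth_exprZ c f : smooth_expr f -> smooth_expr (fun x => c * f x).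
Proof. by move=> sf; apply: smooth_exprM => //; exact: smooth_expr_cst. Qed.

Lemma smooth_expr_step f : smooth_expr f -> smooth_expr (fun x => step (f x)).
Proof.
move=> sf; apply: smooth_exprZ; apply: smooth_expr_flat.
apply: smooth_exprD; first exact: smooth_expr_cst.
under eq_fun do rewrite -mulN1r.
by apply: smooth_exprZ; exact: smooth_expr_flat.
Qed.

Lemma smooth_expr_bump r f : smooth_expr f -> smooth_expr (fun x => bump r (f x)).
Proof.
have H c : smooth_expr f -> smooth_expr (fun x => step (c * f x / r - 1)).
  move=> sf; apply: smooth_expr_step; apply: smooth_exprD; last exact: smooth_expr_cst.
  by apply: smooth_exprM; [exact: smooth_exprZ|exact: smooth_expr_cst].
move=> sf; apply: smooth_exprM.
  by have := H 1 sf; under eq_fun do rewrite mul1r.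
by have := H (-1) sf; under eq_fun do rewrite mulN1r.
Qed.

End smooth_expr.

(** * Poincare inequality on perforated space *)

Section poincare_line.
Context (R : realType).
Local Notation mu := (@lebesgue_measure R).

(** Bounding the sum by twice its larger term avoids convexity, at the price of a slightly worse
    constant. *)
Lemma powRD_le (p a b : R) : 0 <= p -> 0 <= a -> 0 <= b ->
  (a + b) `^ p <= 2 `^ p * (a `^ p + b `^ p).
Proof.
move=> p0 a0 b0; wlog ab : a b a0 b0 / a <= b.
  move=> H; have [ab|/ltW ba] := leP a b; first exact: H.
  by rewrite addrC (addrC (a `^ p)); exact: H.
apply: (@le_trans _ _ ((2 * b) `^ p)).
  by rewrite ge0_ler_powR ?nnegrE ?addr_ge0 ?mulr_ge0//; lra.
by rewrite powRM// ler_wpM2l ?powR_ge0// lerDr powR_ge0.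
Qed.

Lemma ge0_le_integralT d (T : measurableType d) (nu : {measure set T -> \bar R})
    (f g : T -> \bar R) :
  measurable_fun setT f -> measurable_fun setT g -> (forall x, (0 <= f x)%E) ->
  (forall x, (f x <= g x)%E) -> (\int[nu]_x f x <= \int[nu]_x g x)%E.
Proof. by move=> mf mg f0 fg; apply: ge0_le_integral => //. Qed.

Lemma measurable_norm_powR (p : R) d (T : measurableType d) (f : T -> R) :
  measurable_fun setT f -> measurable_fun setT (fun x => `|f x| `^ p).
Proof.
move=> mf; apply: (measurableT_comp (f := @powR R ^~ p)); first exact: measurable_powR.
exact: measurableT_comp.
Qed.

(* Fundamental theorem of calculus, then Hoelder on [b, c]. *)
Lemma powR_increment_le (p : R) (f df : R -> R) (b c : R) :
  1 < p -> b <= c -> (forall t : R, is_derive t (1 : R) f (df t)) -> continuous df ->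
  ((`|f c - f b| `^ p)%:E <=
   ((c - b) `^ (p - 1))%:E * \int[mu]_(t in `[b, c]) (`|df t| `^ p)%:E)%E.
Proof.
move=> p1 bc fdf cdf; have p0 : 0 < p by lra.
move: bc; rewrite le_eqVlt => /predU1P[->|bc].
  rewrite subrr normr0 powR0 ?gt_eqF// mule_ge0 ?lee_fin ?powR_ge0//.
  by apply: integral_ge0 => t _; rewrite lee_fin powR_ge0.
have mdf : measurable_fun setT df by exact: continuous_measurable_fun.
have cf : continuous f.
  move=> x; apply/differentiable_continuous/derivable1_diffP.
  exact: (@ex_derive _ _ _ _ _ _ _ (fdf x)).
have ftc : (\int[mu]_(x in `[b, c]) (df x)%:E = (f c)%:E - (f b)%:E)%E.
  apply: continuous_FTC2 => //.
  - exact: continuous_subspaceT.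
  - split.
    + by move=> x _; exact: (@ex_derive _ _ _ _ _ _ _ (fdf x)).
    + by apply: cvg_at_right_filter; exact: cf.
    + by apply: cvg_at_left_filter; exact: cf.
  - by move=> x _; rewrite derive1E; exact: (@derive_val _ _ _ _ _ _ _ (fdf x)).
(* The conjugate exponent: p / q = p - 1 will be the power of the length [c - b]. *)
pose q := p / (p - 1).
have q0 : 0 < q by rewrite divr_gt0//; lra.
have pq : p^-1 + q^-1 = 1 by rewrite /q; field; apply/andP; split; rewrite gt_eqF//; lra.
pose I : set R := `[b, c]%classic.
have mI : measurable I by exact: measurable_itv.
pose A := (\int[mu]_(t in I) (`|df t| `^ p)%:E)%E.
have A0 : (0 <= A)%E by apply: integral_ge0 => t _; rewrite lee_fin powR_ge0.
have H1 : ((`|f c - f b|)%:E <= A `^ p^-1 * ((c - b) `^ q^-1)%:E)%E.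
  have := @hoelder _ _ _ mu (df \_ I) (\1_I) p q
     ((measurable_restrictT df mI).1 (measurable_funTS mdf)) (measurable_indic mI) p0 q0 pq.
  rewrite Lnorm1.
  have -> : (\int[mu]_x `|(EFin \o (df \_ I \* \1_I)%R) x| = \int[mu]_(x in I) `|(df x)%:E|)%E.
    rewrite [RHS]integral_mkcond; apply: eq_integral => x _.
    rewrite /= !patchE indicE; case: ifPn => xI; last by rewrite mulr0 normr0.
    by rewrite mulr1.
  have -> : ('N[mu]_p%:E[EFin \o (df \_ I)] = A `^ p^-1)%E.
    have -> : A = (\int[mu]_x `|(EFin \o df \_ I) x| `^ p)%E; last first.
      by rewrite Lnorm.unlock.
    rewrite /A [LHS]integral_mkcond.
    apply: eq_integral => x _; rewrite /= !patchE; case: ifPn => xI //=.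
    by rewrite normr0 powR0 ?gt_eqF.
  have -> : ('N[mu]_q%:E[EFin \o (\1_I)] = ((c - b) `^ q^-1)%:E)%E.
    rewrite -poweR_EFin.
    have -> : ((c - b)%:E = \int[mu]_x `|(EFin \o \1_I) x| `^ q)%E; last first.
      by rewrite Lnorm.unlock.
    rewrite -[LHS](_ : mu I = (c - b)%:E)%E; last first.
      by rewrite /I lebesgue_measure_itv/= lte_fin bc.
    transitivity (\int[mu]_x (\1_I x)%:E)%E; first by rewrite integral_indic// setIT.
    apply: eq_integral => x _.
    rewrite /= indicE; case: (x \in I) => /=; rewrite ?normr1 ?normr0 ?powR1//.
    by rewrite powR0 ?gt_eqF.
  apply: le_trans; have := le_abse_integral mu mI ((measurable_EFinP _ _).2 (measurable_funTS mdf)).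
  by rewrite /= ftc.
(* An infinite energy makes the right-hand side infinite, because [b < c] keeps its factor
   positive. *)
move: H1; rewrite -/I -/A; case: A A0 => [r r0|_ _|//]; last first.
  by rewrite gt0_muley ?leey// lte_fin powR_gt0// subr_gt0.
rewrite poweR_EFin -!EFinM !lee_fin => H1.
apply: (@le_trans _ _ ((r `^ p^-1 * (c - b) `^ q^-1) `^ p)).
  by rewrite ge0_ler_powR ?nnegrE ?mulr_ge0 ?powR_ge0// ltW.
rewrite lee_fin in r0.
rewrite powRM ?powR_ge0// -!powRrM mulVf ?gt_eqF// powRr1// mulrC.
rewrite (_ : q^-1 * p = p - 1)// /q; field; apply/andP; split; rewrite gt_eqF//; lra.
Qed.

End poincare_line.

Section poincare.
Context (R : realType) (n : nat) (p : R) (hp : 1 < p).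
Local Notation mu := (@lebesgue_measure R).
Local Notation leb := (lebesgue_rV R n).
Local Notation e i := (delta_mx ord0 i : 'rV[R]_n).
Implicit Types (x : 'rV[R]_n) (i : 'I_n).

Variables (u : 'rV[R]_n -> R).
Hypothesis cu : continuous u.
Hypothesis du : forall i x, derivable u x (e i).
Hypothesis cdu : forall i, continuous (partial i u).
Variable l : R.
Hypothesis l0 : 0 < l.

Let I : set R := `[- (l / 2), l / 2]%classic.

(** The segment is the full one of length [l] centred at [x], and not the piece leading to a zero of
    [u]. It does not depend on where the zero is, so the energy is measurable in [x] and Tonelli
    applies. *)
Definition line_energy i x : \bar R :=
  (\int[mu]_t ((`|partial i u (x + t *: e i)| `^ p * \1_I t)%:E))%E.

Lemma is_derive_line i x (t : R) :
  is_derive t (1 : R) (fun s : R => u (x + s *: e i)) (partial i u (x + t *: e i)).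
Proof.
have H : derivable u (x + t *: e i) (e i) by exact: du.
apply: DeriveDef.
  move: H => /derivable1P H.
  have -> : (fun s : R => u (x + s *: e i)) =
    (fun s : R => u (s *: e i + (x + t *: e i))) \o (fun s => s - t).
    by apply/funext => s /=; rewrite scalerBl addrCA subrK.
  apply/derivable1_diffP; apply: differentiable_comp; last first.
    by rewrite subrr; apply/derivable1_diffP.
  by apply: differentiableB => //; exact: differentiable_cst.
rewrite /partial /derive; set g1 := (fun h => _); set g2 := (fun h => _).
suff -> : g1 = g2 by [].
rewrite funeqE /g1 /g2 => h /=; congr (_ *: (u _ - _)).
by rewrite [h%:A]mulr1 scalerDl addrCA.
Qed.

Lemma line_energy_ge0 i x : (0 <= line_energy i x)%E.
Proof. by apply: integral_ge0 => t _; rewrite lee_fin mulr_ge0 ?powR_ge0. Qed.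

(** The segment from 0 to [a], in either order, lies in the window and has length at most [l];
    enlarging both the integral and the length factor removes the dependence on [a]. *)
Lemma increment_le_line_energy i x a : `|a| <= l / 2 ->
  ((`|u (x + a *: e i) - u x| `^ p)%:E <= (l `^ (p - 1))%:E * line_energy i x)%E.
Proof.
move=> al; pose f (s : R) := u (x + s *: e i); pose df (s : R) := partial i u (x + s *: e i).
have fdf t : is_derive t (1 : R) f (df t) by exact: is_derive_line.
have cdf : continuous df.
  move=> t; apply: (@continuous_comp _ _ _ (fun s : R => x + s *: e i) (partial i u)); last exact: cdu.
  by apply: cvgD; [exact: cvg_cst|apply: cvgZr_tmp].
have main b c : b <= c -> `[b, c]%classic `<=` I -> c - b <= l ->
    ((`|f c - f b| `^ p)%:E <= (l `^ (p - 1))%:E * line_energy i x)%E.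
  move=> bc bcI cbl; apply: le_trans (powR_increment_le hp bc fdf cdf) _.
  apply: lee_pmul; rewrite ?lee_fin ?powR_ge0//.
  - by apply: integral_ge0 => t _; rewrite lee_fin powR_ge0.
  - apply: (@ge0_ler_powR R (p - 1)) => //; rewrite ?nnegrE ?subr_ge0//; exact: ltW.
  - rewrite /line_energy integral_mkcond; apply: ge0_le_integral => //.
    + by move=> t _; apply: erestrict_ge0 => s _; rewrite lee_fin powR_ge0.
    + apply/(measurable_restrictT _ _).1 => //; apply/measurable_EFinP/measurable_funTS.
      by apply: measurable_norm_powR; exact: continuous_measurable_fun.
    + apply/measurable_EFinP/measurable_funM; last exact: (measurable_indic (measurable_itv _)).
      by apply: measurable_norm_powR; exact: continuous_measurable_fun.
    + move=> t _; rewrite patchE indicE; case: ifPn => tI; last first.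
        by rewrite lee_fin mulr_ge0 ?powR_ge0.
      by rewrite mem_set ?mulr1//; apply: bcI; exact: set_mem.
move: al; rewrite ler_norml => /andP[a1 a2].
have fx : f 0 = u x by rewrite /f scale0r addr0.
rewrite -fx -/(f a); have [a0|/ltW a0] := leP 0 a.
  apply: main => //; last lra.
  by move=> t; rewrite /I /= !in_itv/= => /andP[? ?]; apply/andP; split; lra.
rewrite distrC; apply: main => //; last lra.
by move=> t; rewrite /I /= !in_itv/= => /andP[? ?]; apply/andP; split; lra.
Qed.

Lemma measurable_line i : measurable_fun setT
  (fun z : 'rV[R]_n * measurableTypeR R => z.1 + (z.2 : R) *: e i).
Proof.
apply: measurable_fun_coorP => j.
rewrite (_ : (fun _ => _) = (fun z : 'rV[R]_n * measurableTypeR R =>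
    z.1 ord0 j + (z.2 : R) * e i ord0 j)); last first.
  by apply/funext => z; rewrite !mxE.
apply: measurable_funD.
  exact: (measurableT_comp (measurable_coor j) measurable_fst).
apply: measurable_funM => //; exact: measurable_snd.
Qed.

Let F i (z : 'rV[R]_n * measurableTypeR R) : \bar R :=
  (`|partial i u (z.1 + (z.2 : R) *: e i)| `^ p * \1_I z.2)%:E.

Let F0 i z : (0 <= F i z)%E. Proof. by rewrite lee_fin mulr_ge0 ?powR_ge0. Qed.

Let mF i : measurable_fun setT (F i).
Proof.
apply/measurable_EFinP/measurable_funM.
  apply: measurable_norm_powR.
  exact: (measurableT_comp (continuous_measurable_rV (@cdu i)) (measurable_line i)).
apply: (measurableT_comp (f := \1_I : measurableTypeR R -> R)); last exact: measurable_snd.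
exact: (measurable_indic (measurable_itv _)).
Qed.

Lemma measurable_line_energy i : measurable_fun setT (line_energy i).
Proof. exact: (measurable_fun_fubini_tonelli_F (F i) (mF i) (F0 i)). Qed.

(** By Tonelli and translation invariance each [t] contributes the same integral, and the window of
    [t] has length [l]. *)
Lemma integral_line_energy i :
  (\int[leb]_x line_energy i x = l%:E * \int[leb]_x (`|partial i u x| `^ p)%:E)%E.
Proof.
transitivity (\int[mu]_t \int[leb]_x F i (x, t))%E.
  exact: (fubini_tonelli (F i) (mF i) (F0 i)).
pose J := (\int[leb]_x (`|partial i u x| `^ p)%:E)%E.
transitivity (\int[mu]_t ((\1_I t)%:E * J))%E.
  apply: eq_integral => t _; rewrite /F/=.
  under eq_integral do rewrite mulrC EFinM.
  pose g (x : 'rV[R]_n) := (`|partial i u (x + (t : R) *: e i)| `^ p)%:E.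
  have mg : measurable_fun setT g.
    apply/measurable_EFinP/measurable_norm_powR.
    exact: (measurableT_comp (continuous_measurable_rV (@cdu i)) (measurable_shift_rV _)).
  have := @ge0_integralZl_EFin _ _ _ leb setT measurableT g.
  move=> /(_ (fun x _ => powR_ge0 _ _) mg (\1_I t)) ->; last by rewrite indicE.
  suff -> : (\int[leb]_x g x = J)%E by [].
  apply: (@ge0_integral_shift_rV R n (fun x => (`|partial i u x| `^ p)%:E)).
    apply/measurable_EFinP/measurable_norm_powR.
    exact: continuous_measurable_rV.
  by move=> x; rewrite lee_fin powR_ge0.
rewrite ge0_integralZr//; last 2 first.
- by apply/measurable_EFinP; exact: (measurable_indic (measurable_itv _)).
- by apply: integral_ge0 => x _; rewrite lee_fin powR_ge0.
have muI : mu I = l%:E.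
  rewrite /I lebesgue_measure_itv/= lte_fin ifT; last by have := l0; lra.
  by rewrite -EFinD (_ : l / 2 - - (l / 2) = l)//; have := l0; lra.
have -> : (\int[mu]_x (\1_I x)%:E = l%:E)%E; last by [].
by rewrite integral_indic ?setIT//; exact: measurable_itv.
Qed.

(** The windows are the shadows of the slits in a transversal coordinate, continued periodically to
    the whole line. *)
Definition near_lattice (t : R) : Prop := exists z : int, `|t - l * z%:~R| <= l / 4.

(** Windows and gaps both have length l/2, so a translation by half a period carries each gap into a
    window. In units of [l], the fractional part of a point of a gap lies strictly between 1/4 and
    3/4. *)
Lemma near_lattice_half t : ~ near_lattice t -> near_lattice (t - l / 2).
Proof.
move=> nG; pose s := t / l.
have sl : t = s * l by rewrite /s divfK ?gt_eqF.
have [f1 f2] : (Num.floor s)%:~R <= s /\ s < (Num.floor s)%:~R + 1.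
  by have /andP[? ?] := floor_itv s; rewrite -intrD1.
exists (Num.floor s); set z : R := (Num.floor s)%:~R in f1 f2 *.
have h1 : ~ s - z <= 1 / 4.
  move=> h; apply: nG; exists (Num.floor s); rewrite -/z sl (mulrC l) -mulrBl normrM.
  by rewrite (gtr0_norm l0) mulrC ler_pM2l// ger0_norm; lra.
have h2 : ~ s - z >= 3 / 4.
  move=> h; apply: nG; exists (Num.floor s + 1); rewrite intrD -/z sl (mulrC l) -mulrBl normrM.
  by rewrite (gtr0_norm l0) mulrC ler_pM2l// ler0_norm; lra.
move/negP in h1; move/negP in h2; rewrite -!ltNge in h1 h2.
have -> : t - l / 2 - l * z = l * (s - 1 / 2 - z) by rewrite sl; field.
rewrite normrM (gtr0_norm l0) ler_pM2l// ler_norml; apply/andP; split; lra.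
Qed.

Lemma measurable_near_lattice : measurable [set t : R | near_lattice t].
Proof.
have -> : [set t : R | near_lattice t] =
    \bigcup_(k in [set: nat]) (if unpickle k is Some z then
      `[l * (z : int)%:~R - l / 4, l * z%:~R + l / 4]%classic else set0).
  apply/seteqP; split => [t [z Hz]|t [k _]].
    exists (pickle z); first by [].
    rewrite pickleK; change (t \in `[l * z%:~R - l / 4, l * z%:~R + l / 4]); rewrite in_itv/=.
    by move: Hz; rewrite ler_norml => /andP[? ?]; apply/andP; split; lra.
  case: unpickle => // z /=; rewrite in_itv/= => /andP[? ?].
  by exists z; rewrite ler_norml; apply/andP; split; lra.
by apply: bigcup_measurable => k _; case: unpickle.
Qed.

(** Coordinates below [k] have already been freed and the last one is always free: [tube 0] is the
    region over the windows and [tube n.-1] is the whole space. *)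
Definition tube (k : nat) : set 'rV[R]_n :=
  [set x | forall i : 'I_n, (k <= i < n.-1)%N -> near_lattice (x ord0 i)].

Lemma measurable_tube k : measurable (tube k).
Proof.
have -> : tube k = box (fun i : 'I_n =>
    if (k <= i < n.-1)%N then [set t : R | near_lattice t] else setT).
  apply/seteqP; split => x H i.
    by case: ifPn => // /H.
  by move=> ki; have := H i; rewrite ki.
by apply: measurable_box => i; case: ifPn => // _; exact: measurable_near_lattice.
Qed.

Local Notation E := (\int[leb]_x (`|enorm (grad u x)| `^ p)%:E)%E.
Local Notation Ik k := (\int[leb]_x (`|u x| `^ p * \1_(tube k) x)%:E)%E.

Let mIk k : measurable_fun setT (fun x : 'rV[R]_n => (`|u x| `^ p * \1_(tube k) x)%:E).
Proof.
apply/measurable_EFinP/measurable_funM; last exact: measurable_indic (measurable_tube k).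
by apply: measurable_norm_powR; exact: continuous_measurable_rV.
Qed.

Let Ik0 k x : (0 <= (`|u x| `^ p * \1_(tube k) x)%:E)%E.
Proof. by rewrite lee_fin mulr_ge0 ?powR_ge0. Qed.

Lemma measurable_norm_grad : measurable_fun setT (fun x => `|enorm (grad u x)| `^ p).
Proof.
apply: measurable_norm_powR; apply: (measurableT_comp (@measurable_enorm R n)).
apply: measurable_fun_coorP => i; under eq_fun do rewrite mxE.
exact: continuous_measurable_rV.
Qed.

Lemma integral_partial_le i :
  (\int[leb]_x (`|partial i u x| `^ p)%:E <= E)%E.
Proof.
apply: ge0_le_integral => //.
- by apply/measurable_EFinP/measurable_norm_powR; exact: continuous_measurable_rV.
- by apply/measurable_EFinP; exact: measurable_norm_grad.
- move=> x _; rewrite lee_fin; apply: (@ge0_ler_powR R p); rewrite ?nnegrE//; first by have := hp; lra.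
  rewrite [leRHS]ger0_norm ?sqrtr_ge0//; apply: le_trans (norm_rV_le_enorm _).
  by apply: le_trans (le_norm_coord _ i); rewrite mxE.
Qed.

Lemma integral_line_energy_le i :
  (\int[leb]_x line_energy i x <= l%:E * E)%E.
Proof.
by rewrite integral_line_energy; apply: lee_wpmul2l; [rewrite lee_fin ltW|exact: integral_partial_le].
Qed.

Let powR_l : l `^ (p - 1) * l = l `^ p.
Proof. by rewrite -[X in _ * X]powRr1 ?ltW// -powRD ?subrK// (lt0r_neq0 l0) implybT. Qed.

Let D i := (\int[leb]_x ((l `^ (p - 1))%:E * line_energy i x))%E.

Let scaled_line_energy_le i : ((l `^ (p - 1))%:E * \int[leb]_x line_energy i x <= (l `^ p)%:E * E)%E.
Proof.
rewrite -powR_l EFinM -muleA; apply: lee_wpmul2l; rewrite ?lee_fin ?powR_ge0//.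
exact: integral_line_energy_le.
Qed.

Let D_le i : (D i <= (l `^ p)%:E * E)%E.
Proof.
rewrite /D ge0_integralZl_EFin ?powR_ge0//.
- by move=> x _; exact: line_energy_ge0.
- exact: measurable_line_energy.
Qed.

(** A point gained in passing from [tube i] to [tube i.+1] has its coordinate [i] in a gap, so the
    half-period translate by [v] lies in [tube i]. There [u] is compared with its translate through
    the line energy. In the factor 1 + 2^p, the 1 accounts for points already in [tube i] and the
    2^p for the translated ones. *)
Lemma tube_step (i : 'I_n) : (i < n.-1)%N ->
  (Ik i.+1 <= (1 + 2 `^ p)%:E * Ik i + (2 `^ p * l `^ p)%:E * E)%E.
Proof.
move=> im; pose v : 'rV[R]_n := (- (l / 2)) *: e i.
pose f (x : 'rV[R]_n) := (`|u x| `^ p * \1_(tube i) x)%:E.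
pose g (x : 'rV[R]_n) := ((2 `^ p)%:E * f (x + v)%R +
  (2 `^ p)%:E * ((l `^ (p - 1))%:E * line_energy i x))%E.
have mfv : measurable_fun setT (fun x => f (x + v)%R).
  exact: (measurableT_comp (mIk i) (measurable_shift_rV v)).
have f0 x : (0 <= f x)%E by exact: Ik0.
have D0 x : (0 <= (l `^ (p - 1))%:E * line_energy i x)%E.
  by rewrite mule_ge0 ?lee_fin ?powR_ge0//; exact: line_energy_ge0.
have mD : measurable_fun setT (fun x => (l `^ (p - 1))%:E * line_energy i x)%E.
  by apply: measurable_funeM; exact: measurable_line_energy.
have g0 x : (0 <= g x)%E by rewrite adde_ge0// mule_ge0 ?lee_fin ?powR_ge0.
have mg : measurable_fun setT g.
  by apply: emeasurable_funD; exact: measurable_funeM.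
have key x : ((`|u x| `^ p * \1_(tube i.+1) x)%:E <= f x + g x)%E.
  have [xi1|xi1] := boolP (x \in tube i.+1); last first.
    by rewrite indicE (negbTE xi1) mulr0 adde_ge0.
  have [xi|xi] := boolP (x \in tube i).
    by rewrite /f !indicE xi xi1 leeDl.
  have nG : ~ near_lattice (x ord0 i).
    move=> G; move/negP: xi; apply; rewrite inE => j /andP[].
    rewrite leq_eqVlt => /predU1P[/val_inj <-//|ij jn].
    by move: xi1; rewrite inE => /(_ j); rewrite ij jn; exact.
  have xv : x + v \in tube i.
    rewrite inE => j /andP[ij jn]; rewrite !mxE eqxx/=.
    have [->|ji] := eqVneq j i; first by rewrite mulr1; exact: near_lattice_half.
    rewrite mulr0 addr0; move: xi1; rewrite inE => /(_ j); apply.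
    by rewrite jn andbT ltn_neqAle ij andbT eq_sym; apply: contraNneq ji => /val_inj ->.
  rewrite {1}/f !indicE xi1 (negbTE xi) mulr0 add0e mulr1 /g /f indicE xv mulr1.
  have H := @increment_le_line_energy i x (- (l / 2)).
  rewrite normrN gtr0_norm ?divr_gt0// lexx in H.
  rewrite -ge0_muleDr ?D0 ?lee_fin ?powR_ge0//.
  apply: (@le_trans _ _ ((2 `^ p)%:E * ((`|u (x + v)| `^ p)%:E + (`|u (x + v) - u x| `^ p)%:E))%E).
    rewrite -EFinD -EFinM lee_fin.
    apply: le_trans (powRD_le _ _ _) => //; last by have := hp; lra.
    apply: (@ge0_ler_powR R p); rewrite ?nnegrE ?addr_ge0//; first by have := hp; lra.
    rewrite -{1}(subKr (u (x + v)) (u x)); exact: ler_normB.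
  apply: lee_wpmul2l; rewrite ?lee_fin ?powR_ge0//; apply: leeD => //.
  exact: H.
apply: (@le_trans _ _ (\int[leb]_x (f x + g x))%E).
  apply: ge0_le_integralT => //; exact: (emeasurable_funD (mIk i) mg).
rewrite ge0_integralD//; last exact: mIk.
rewrite /g ge0_integralD//; first last.
- exact: measurable_funeM.
- by move=> x _; rewrite mule_ge0 ?lee_fin ?powR_ge0.
- exact: measurable_funeM.
- by move=> x _; rewrite mule_ge0 ?lee_fin ?powR_ge0.
rewrite !ge0_integralZl_EFin ?powR_ge0//.
have -> := ge0_integral_shift_rV v (mIk i) (Ik0 i).
rewrite addeA EFinD ge0_muleDl ?lee_fin ?powR_ge0// mul1e.
apply: leeD => //; rewrite EFinM -muleA; apply: lee_wpmul2l; rewrite ?lee_fin ?powR_ge0//.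
- by move=> x _; exact: line_energy_ge0.
- exact: measurable_line_energy.
Qed.

(** A zero of [u] within l/2 turns the bound on an increment into a bound on [u] itself. Asking for
    it only where [u] does not vanish lets the application know that [x] belongs to the perforated
    set. *)
Lemma tube0_le (m : 'I_n) :
  (forall x, tube 0 x -> u x != 0 -> exists2 a, `|a| <= l / 2 & u (x + a *: e m) = 0) ->
  (Ik 0 <= (l `^ p)%:E * E)%E.
Proof.
move=> H; apply: le_trans (D_le m); apply: ge0_le_integralT => //.
- by apply: measurable_funeM; exact: measurable_line_energy.
- move=> x; have D0 : (0 <= (l `^ (p - 1))%:E * line_energy m x)%E.
    by rewrite mule_ge0 ?lee_fin ?powR_ge0//; exact: line_energy_ge0.
  have [xi|xi] := boolP (x \in tube 0); last by rewrite indicE (negbTE xi) mulr0.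
  rewrite indicE xi mulr1; have [ux|ux] := eqVneq (u x) 0.
    by rewrite ux normr0 powR0// gt_eqF//; have := hp; lra.
  have [a al ua] := H x (set_mem xi) ux.
  by have := increment_le_line_energy m x al; rewrite ua sub0r normrN.
Qed.

(** The start 1 is the constant of [tube0_le]; each iteration is one use of [tube_step], so [k]
    counts the freed coordinates. *)
Definition poincare_cst (k : nat) : R := iter k (fun c => (1 + 2 `^ p) * c + 2 `^ p) 1.

Lemma poincare_cst_gt0 k : 0 < poincare_cst k.
Proof.
elim: k => //= k IH; rewrite addr_gt0 ?mulr_gt0 ?powR_gt0//.
Qed.

Lemma poincare (m : 'I_n) : m.+1 = n ->
  (forall x, tube 0 x -> u x != 0 -> exists2 a, `|a| <= l / 2 & u (x + a *: e m) = 0) ->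
  (\int[leb]_x (`|u x| `^ p)%:E <= (poincare_cst n.-1 * l `^ p)%:E * E)%E.
Proof.
move=> mn H.
have E0 : (0 <= E)%E by apply: integral_ge0 => x _; rewrite lee_fin powR_ge0.
have main k : (k <= n.-1)%N -> (Ik k <= (poincare_cst k * l `^ p)%:E * E)%E.
  elim: k => [_|k IH kn]; first by rewrite mul1r; exact: tube0_le H.
  have kn' : (k < n)%N by rewrite (leq_trans kn)// leq_pred.
  apply: le_trans (@tube_step (Ordinal kn') kn) _ => /=.
  have -> : ((((1 + 2 `^ p) * poincare_cst k + 2 `^ p) * l `^ p)%:E =
      ((1 + 2 `^ p) * (poincare_cst k * l `^ p))%:E + (2 `^ p * l `^ p)%:E)%E.
    by rewrite -EFinD; congr EFin; ring.
  have c0 := ltW (poincare_cst_gt0 k).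
  rewrite ge0_muleDl ?lee_fin ?mulr_ge0 ?addr_ge0 ?powR_ge0//.
  apply: leeD => //; rewrite EFinM -muleA; apply: lee_wpmul2l; last by exact: IH (ltnW kn).
  by rewrite lee_fin addr_ge0 ?powR_ge0.
apply: le_trans (main n.-1 (leqnn _)).
(* The last tube imposes no condition, so its indicator is 1 everywhere. *)
rewrite le_eqVlt; apply/orP; left; apply/eqP; apply: eq_integral => x _.
rewrite indicE mem_set ?mulr1// => i /andP[h1 h2].
by have := leq_ltn_trans h1 h2; rewrite ltnn.
Qed.

End poincare.

(** * Perforated cubes *)

Section domains.
Context (R : realType) (N : nat) (m : 'I_N) (hm : m.+1 = N).
Variables (l : R) (n : nat).
Hypothesis l0 : 0 < l.
Implicit Types (x : 'rV[R]_N) (i : 'I_N).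

Local Notation r := (l * (n%:R + 1 / 2)).

Lemma dilateP (c : R) (A : set 'rV[R]_N) x : c != 0 -> dilate c A x <-> A (c^-1 *: x).
Proof.
move=> c0; split=> [[y Ay <-]|Ax]; first by rewrite scalerA mulVf// scale1r.
by exists (c^-1 *: x) => //; rewrite scalerA mulfV// scale1r.
Qed.

(* Both families of the theorem are of this form: l = 1 for Omega_tilde and
   l = 1 / (2 n + 1) for Omega. *)
Definition dom : set 'rV[R]_N := dilate l (Omega_tilde R N n).

Lemma last_eq i : (i.+1 == N) = (i == m).
Proof. by apply/eqP/eqP => [h|->//]; apply/val_inj/succn_inj; rewrite h hm. Qed.

Lemma dom_cube x i : dom x -> `|x ord0 i| < r.
Proof.
move=> /(dilateP _ _ (lt0r_neq0 l0))[/(_ i)]; rewrite !mxE => /andP[h1 h2] _.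
rewrite ltr_norml; apply/andP; split; first by rewrite -mulrN -ltr_pdivlMl.
by rewrite -ltr_pdivrMl.
Qed.

Lemma ltr_int_le (z : int) : `|z%:~R : R| < n%:R + 1 -> (`|z| <= n)%N.
Proof.
by rewrite -ltnS -(ltr_nat R) natr_absz -natr1 intr_norm.
Qed.

(** Such a point would lie on the slit at [z], with [z] given by the nearby lattice points and by
    [k] in the last place. What must be checked is that this slit was really removed: |x_i| < l (n +
    1/2) and a distance at most l/4 give |z_i| < n + 1, hence |z_i| <= n. *)
Lemma dom_slit x (k : int) : dom x -> (forall i, i != m -> near_lattice l (x ord0 i)) ->
  x ord0 m != l * k%:~R.
Proof.
move=> Dx H; apply/negP => /eqP xk.
have xr i := dom_cube i Dx.
have Hz i : {z : int | (i != m -> `|x ord0 i - l * z%:~R| <= l / 4) &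
    (i = m -> z = k)}.
  apply: cid2; have [im|im] := eqVneq i m; first by exists k.
  by have [z Hz] := H _ im; exists z => // ?; case/eqP: im.
pose z : 'rV[int]_N := \row_i s2val (Hz i).
move: Dx => /(dilateP _ _ (lt0r_neq0 l0))[_]; apply; exists z.
  apply/bigmax_leqP => i _; apply: ltr_int_le; rewrite mxE.
  case: (Hz i) => zi /= h1 h2; rewrite -(ltr_pM2l l0) -{1}(gtr0_norm l0) -normrM.
  have := xr i; have [im|im] := eqVneq i m.
    by rewrite (h2 im) im xk; move=> h; apply: lt_trans h _; rewrite ltr_pM2l//; lra.
  have := h1 im; rewrite !ler_norml ltr_norml => /andP[? ?] /andP[? ?].
  rewrite ltr_norml; apply/andP; split; nra.
exists (l^-1 *: x - map_mx intr z); last by rewrite subrK.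
move=> i; rewrite last_eq !mxE; case: (Hz i) => zi /= h1 h2; case: ifPn => [/eqP im|im].
  by rewrite (h2 im) im xk mulrA mulVf ?gt_eqF// mul1r subrr.
rewrite -ler_norml -(ler_pM2l l0) -{1}(gtr0_norm l0) -normrM mulrBr mulrA mulfV ?gt_eqF// !mul1r.
exact: h1.
Qed.

(** Avoiding entire hyperplanes is more than membership requires, but it is a condition on the last
    coordinate alone, so one-variable cutoffs can enforce it. *)
Lemma mem_dom x : (forall i, `|x ord0 i| < r) ->
  (forall k : int, (`|k| <= n)%N -> x ord0 m != l * k%:~R) -> dom x.
Proof.
move=> xr H; apply/dilateP; first exact: lt0r_neq0.
split.
  move=> i; have := xr i; rewrite ltr_norml mxE => /andP[h1 h2].
  by rewrite -ltr_pdivrMl ?invr_gt0// invrK mulrN h1 ltr_pdivrMl.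
move=> [z /bigmax_leqP zn [w sw wE]].
move/eqP: (H (z ord0 m) (zn m isT)); apply.
have := congr1 (fun v : 'rV[R]_N => l * v ord0 m) wE; rewrite !mxE.
have := sw m; rewrite last_eq eqxx => ->.
by rewrite add0r mulrA mulfV ?gt_eqF// mul1r.
Qed.

End domains.

Section supports.
Context (R : realType) (N : nat).
Implicit Types (u : 'rV[R]_N -> R) (A : set 'rV[R]_N).

Lemma neq0_supp u x : u x != 0 -> supp u x.
Proof. by move=> ux; apply: subset_closure. Qed.

Lemma grad_supp u x : enorm (grad u x) != 0 -> supp u x.
Proof.
move=> Hx; apply: contrapT => nx; move/eqP: Hx; apply.
have near0 : \forall y \near x, 0 = u y.
  have oc : open (~` supp u) by exact/closed_openC/closed_closure.
  have := oc x nx; apply: filterS => y ny; apply/eqP; rewrite eq_sym; apply/negPn/negP => /neq0_supp.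
  exact: ny.
rewrite /enorm big1 ?sqrtr0// => i _; rewrite mxE /partial.
by rewrite -(near_eq_derive _ near0) derive_cst expr0n.
Qed.

Lemma Lp_norm_poweR A (p : R) u : p != 0 -> (forall x, u x != 0 -> A x) ->
  (Lp_norm A p u `^ p = \int[lebesgue_rV R N]_x (`|u x| `^ p)%:E)%E.
Proof.
move=> p0 H; apply: etrans (poweR_Lnorm _ _ p0) _; apply: eq_integral => x _ /=.
rewrite patchE; case: ifPn => // /negP nA.
suff -> : u x = 0 by [].
by apply/eqP/negPn/negP => /H; rewrite -inE.
Qed.

End supports.

Section lambda1_lower.
Context (R : realType) (N : nat) (m : 'I_N) (hm : m.+1 = N) (p : R) (hp : 1 < p).

Lemma lambda1_dom_ge (l : R) n : 0 < l ->
  (((poincare_cst p N.-1)^-1 * l `^ (- p))%:E <= lambda1 p (@dom R N l n))%E.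
Proof.
move=> l0; apply: le_ereal_inf_tmp => _ [u [[su cs sD] nu] <-].
have p0 : p != 0 by have := hp; lra.
have supD x : u x != 0 -> @dom R N l n x by move=> /neq0_supp; exact: sD.
have gsupD x : enorm (grad u x) != 0 -> @dom R N l n x by move=> /grad_supp; exact: sD.
have := Lp_norm_poweR p0 supD; rewrite nu poweR_EFin powR1 => n1.
rewrite (Lp_norm_poweR p0 gsupD).
have cu : continuous u by have [] := su [::].
have du i x : derivable u x (delta_mx ord0 i) by have [_] := su [::]; exact.
have cdu i : continuous (partial i u) by have [] := su [:: i].
have := poincare hp cu du cdu l0 hm; rewrite -n1.
set E := (\int[_]_x _)%E => /(_ _); rewrite powRN.
have C0 := poincare_cst_gt0 p N.-1.
have lp0 : 0 < l `^ p by rewrite powR_gt0.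
move=> H; rewrite -invfM -[leLHS]mule1 lee_pdivrMl ?mulr_gt0//; apply: H.
move=> x tx ux; have Dx := supD _ ux.
(* [k] is an integer nearest to x_m / l, so the hyperplane at height l k is at distance at most l/2.
   If [u] did not vanish at the point reached there, that point would be in the domain, against
   [dom_slit]. *)
pose k := Num.floor (x ord0 m / l + 1 / 2).
exists (l * k%:~R - x ord0 m).
  have /andP[h1 h2] := floor_itv (x ord0 m / l + 1 / 2); rewrite -/k intrD1 in h1 h2.
  have xE : x ord0 m = l * (x ord0 m / l) by rewrite mulrC divfK ?gt_eqF.
  rewrite {1}xE -mulrBr normrM (gtr0_norm l0) ler_pM2l// ler_norml; apply/andP; split; lra.
apply/eqP/negPn/negP => /supD D'.
have H i : i != m -> near_lattice l ((x + (l * k%:~R - x ord0 m) *: delta_mx ord0 m) ord0 i).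
  move=> im; rewrite !mxE eqxx (negbTE im) mulr0 addr0; apply: tx.
  by rewrite leq0n/= -ltnS (ltn_predK (ltn_ord i)) ltn_neqAle (last_eq hm) im ltn_ord.
have /negP := dom_slit hm l0 k D' H; apply.
by rewrite !mxE !eqxx mulr1 subrKC.
Qed.

End lambda1_lower.

(** * Truncated fractional kernel *)

Section kernel.
Context (R : realType).

Lemma ge0_integral_scale d (T : measurableType d) (nu : {measure set T -> \bar R})
    (f : T -> R) (c : R) :
  measurable_fun setT f -> (forall x, 0 <= f x) -> 0 <= c ->
  (\int[nu]_x (c * f x)%:E = c%:E * \int[nu]_x (f x)%:E)%E.
Proof.
move=> mf f0 c0; under eq_integral do rewrite EFinM.
apply: ge0_integralZl_EFin => //; first by move=> x _; rewrite lee_fin.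
exact/measurable_EFinP.
Qed.

Lemma geometric_nneseries_le (A q : R) : 0 <= A -> 0 <= q -> q < 1 ->
  (\sum_(0 <= k <oo) (A * q ^+ k)%:E <= (A / (1 - q))%:E)%E.
Proof.
move=> A0 q0 q1; apply: lime_le.
  by apply: is_cvg_nneseries => k _ _; rewrite lee_fin mulr_ge0 ?exprn_ge0.
apply: nearW => k; rewrite sumEFin lee_fin.
have q1' : 0 < 1 - q by rewrite subr_gt0.
have -> : \sum_(0 <= i < k) A * q ^+ i = A * (1 - q ^+ k) / (1 - q).
  apply: (mulIf (lt0r_neq0 q1')); rewrite divfK ?gt_eqF//.
  elim: k => [|k IH]; first by rewrite big_geq// expr0 subrr mulr0 mul0r.
  by rewrite big_nat_recr//= mulrDl IH exprS; ring.
rewrite ler_pM2r ?invr_gt0// -[leRHS]mulr1 ler_wpM2l// gerBl exprn_ge0//.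
Qed.

Lemma nneseries_ge_term (f : nat -> \bar R) k : (forall n, (0 <= f n)%E) ->
  (f k <= \sum_(0 <= n <oo) f n)%E.
Proof.
move=> f0; apply: le_trans (nneseries_lim_ge k.+1 _); last by move=> n _ _; exact: f0.
by rewrite big_nat_recr//= leeDr// sume_ge0.
Qed.

Lemma dyadic_small (s : R) : 0 < s -> s <= 1 ->
  exists k : nat, 2^-1 ^+ k.+1 < s <= 2^-1 ^+ k.
Proof.
move=> s0 s1; have ex : exists k, 2^-1 ^+ k < s.
  exists (Num.truncn s^-1).+1; rewrite exprVn invf_plt ?posrE ?exprn_gt0//.
  apply: lt_le_trans (truncnS_gt _) _; rewrite -natrX ler_nat ltnW// ltn_expl//.
case: (ex_minnP ex) => -[|k] Hk mk; first by rewrite expr0 ltNge s1 in Hk.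
by exists k; rewrite Hk/= leNgt; apply/negP => /mk; rewrite ltnn.
Qed.

Lemma dyadic_large (s : R) : 1 < s ->
  exists k : nat, 2 ^+ k < s <= 2 ^+ k.+1.
Proof.
move=> s1; have ex : exists k, s <= 2 ^+ k.
  exists (Num.truncn s).+1.
  apply: le_trans (ltW (truncnS_gt _)) _; rewrite -natrX ler_nat ltnW// ltn_expl//.
case: (ex_minnP ex) => -[|k] Hk mk; first by rewrite expr0 leNgt s1 in Hk.
by exists k; rewrite Hk andbT ltNge; apply/negP => /mk; rewrite ltnn.
Qed.

Lemma powRX (x b : R) k : 0 <= x -> (x ^+ k) `^ b = (x `^ b) ^+ k.
Proof.
move=> x0; elim: k => [|k IH]; first by rewrite !expr0 powR1.
by rewrite !exprS powRM ?exprn_ge0// IH.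
Qed.

Lemma powR2_lt1 (b : R) : b < 0 -> 2 `^ b < 1 :> R.
Proof. by move=> b0; rewrite /powR pnatr_eq0/= expR_lt1 nmulr_rlt0// ln_gt0// ltr1n. Qed.

Lemma powR2VN (b : R) : (2^-1 : R) `^ (- b) = 2 `^ b.
Proof. by rewrite -powR_inv1// -powRrM mulN1r opprK. Qed.

Context (N : nat) (sigma : R).
Hypothesis sigma0 : 0 < sigma.
Hypothesis sigma1 : sigma < 1.
Local Notation leb := (lebesgue_rV R N).
Local Notation a := (N%:R + sigma).

(** An envelope for the difference quotient of a function that is [L]-Lipschitz with oscillation at
    most 1. It is integrable: near 0 the exponent is a - 1 < N, at infinity it is a > N. The sup
    norm in the numerator makes the level sets cubes, whose volume is explicit. *)
Definition kern (L : R) (h : 'rV[R]_N) : R :=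
  Num.min (L * `|h|) 1 / enorm h `^ a.

Lemma kern_ge0 L h : 0 <= L -> 0 <= kern L h.
Proof. by move=> L0; rewrite divr_ge0 ?powR_ge0// le_min ler01 mulr_ge0. Qed.

Lemma measurable_sub_rV :
  measurable_fun setT (fun z : 'rV[R]_N * 'rV[R]_N => z.1 - z.2).
Proof.
apply: measurable_fun_coorP => i.
rewrite (_ : (fun _ => _) = (fun z : 'rV[R]_N * 'rV[R]_N => z.1 ord0 i - z.2 ord0 i)); last first.
  by apply/funext => z; rewrite !mxE.
apply: measurable_funB.
  exact: (measurableT_comp (measurable_coor i) measurable_fst).
exact: (measurableT_comp (measurable_coor i) measurable_snd).
Qed.

Lemma measurable_norm_rV : measurable_fun setT (fun h : 'rV[R]_N => `|h|).
Proof. by apply: continuous_measurable_rV; exact: norm_continuous. Qed.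

Lemma measurable_kern L : measurable_fun setT (kern L).
Proof.
apply: measurable_funM.
  apply: measurable_minr => //; apply: measurable_funM => //; exact: measurable_norm_rV.
under eq_fun do rewrite -powRN.
apply: (measurableT_comp (f := @powR R ^~ (- a))); first exact: measurable_powR.
exact: measurable_enorm.
Qed.

(** Up to L^a, the first term bounds the kernel where L|h| lies between 2^(-k-1) and 2^(-k), the
    second where it lies between 2^k and 2^(k+1). Full cubes replace the annuli; the overcount stays
    summable. *)
Definition shell (L : R) (k : nat) (h : 'rV[R]_N) : R :=
  2^-1 ^+ k * (2 `^ a) ^+ k.+1 * (L * `|h| <= 2^-1 ^+ k)%R%:R +
  (2 `^ (- a)) ^+ k * (L * `|h| <= 2 ^+ k.+1)%R%:R.

Lemma shell_ge0 L k h : 0 <= shell L k h.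
Proof. by rewrite addr_ge0 ?mulr_ge0 ?exprn_ge0 ?powR_ge0 ?invr_ge0. Qed.

(* Dyadic shells replace polar coordinates in the integration of the kernel. *)
Lemma kern_le_shell L h : 0 < L ->
  ((kern L h)%:E <= (L `^ a)%:E * \sum_(0 <= k <oo) (shell L k h)%:E)%E.
Proof.
move=> L0; have a0 : 0 < a by rewrite ltr_wpDl.
(* At the origin the kernel is 0 by the convention for division by 0. *)
have [->|h0] := eqVneq h 0.
  rewrite /kern (_ : enorm 0 = 0).
    rewrite powR0 ?gt_eqF// invr0 mulr0 mule_ge0 ?lee_fin ?powR_ge0//.
    by apply: nneseries_ge0 => k _ _; rewrite lee_fin shell_ge0.
  by rewrite /enorm big1 ?sqrtr0// => i _; rewrite mxE expr0n.
have nh0 : 0 < `|h| by rewrite normr_gt0.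
have Lh0 : 0 < L * `|h| by rewrite mulr_gt0.
have P k : (((L `^ a) * shell L k h)%:E <= (L `^ a)%:E * \sum_(0 <= k <oo) (shell L k h)%:E)%E.
  rewrite EFinM; apply: lee_wpmul2l; first by rewrite lee_fin powR_ge0.
  by apply: (@nneseries_ge_term (fun k => (shell L k h)%:E)) => j; rewrite lee_fin shell_ge0.
have bnd (t : R) : 0 < t -> t <= L * `|h| -> (enorm h `^ a)^-1 <= L `^ a * t `^ (- a).
  move=> t0 th; have en0 : 0 < enorm h by exact: lt_le_trans nh0 (norm_rV_le_enorm _).
  rewrite powRN ler_pdivlMr ?powR_gt0// ler_pdivrMl ?powR_gt0// -powRM ?(ltW en0) ?(ltW L0)//.
  apply: (@ge0_ler_powR R a (ltW a0)); rewrite ?nnegrE ?mulr_ge0 ?(ltW t0) ?(ltW en0) ?(ltW L0)//.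
  apply: le_trans th _; rewrite mulrC ler_pM2r//; exact: norm_rV_le_enorm.
have [s1|s1] := leP (L * `|h|) 1.
  have [k /andP[k1 k2]] := dyadic_small Lh0 s1.
  apply: le_trans (P k); rewrite lee_fin /kern /shell k2 mulr1.
  rewrite (min_idPl s1) mulrDr.
  have := bnd _ _ (ltW k1); rewrite powRX// powR2VN => /(_ (exprn_gt0 _ _)) H.
  apply: (@le_trans _ _ (2^-1 ^+ k * (L `^ a * 2 `^ a ^+ k.+1))).
    by apply: ler_pM; rewrite ?invr_ge0 ?powR_ge0 ?(ltW Lh0)//; apply: H.
  by rewrite mulrCA lerDl !mulr_ge0 ?exprn_ge0 ?powR_ge0.
have [k /andP[k1 k2]] := dyadic_large s1.
apply: le_trans (P k); rewrite lee_fin /kern /shell k2 mulr1.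
rewrite (min_idPr (ltW s1)) mul1r mulrDr.
have := bnd _ _ (ltW k1); rewrite powRX// => /(_ (exprn_gt0 _ _)) H.
apply: le_trans (H _) _ => //.
by rewrite lerDr !mulr_ge0 ?exprn_ge0 ?powR_ge0 ?invr_ge0.
Qed.

Definition cell (rho : R) (x : 'rV[R]_N) : set 'rV[R]_N := [set y | `|x - y| <= rho].

Lemma cell_box rho x : 0 <= rho ->
  cell rho x = box (fun i => `[x ord0 i - rho, x ord0 i + rho]%classic).
Proof.
move=> r0; apply/seteqP; split => y /=; rewrite /cell/= norm_rV_le//.
  move=> /forallP H i; rewrite /= in_itv/=; have := H i; rewrite !mxE ler_norml => /andP[? ?].
  by apply/andP; split; lra.
move=> H; apply/forallP => i; have := H i; rewrite /= in_itv/= !mxE ler_norml => /andP[? ?].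
by apply/andP; split; lra.
Qed.

Lemma measurable_cell rho x : 0 <= rho -> measurable (cell rho x).
Proof. by move=> r0; rewrite cell_box//; apply: measurable_box => i; exact: measurable_itv. Qed.

Lemma lebesgue_cell rho x : 0 <= rho -> leb (cell rho x) = ((2 * rho) ^+ N)%:E.
Proof.
move=> r0; rewrite cell_box// lebesgue_rV_box; last by move=> i; exact: measurable_itv.
under eq_bigr => i _.
  rewrite lebesgue_measure_itv/= lte_fin -EFinD.
  rewrite (_ : (if _ then _ else _) = (2 * rho)%:E); first over.
  case: ifPn => [_|]; first by congr EFin; ring.
  by rewrite -leNgt => H; congr EFin; lra.
by rewrite prodEFin prodr_const card_ord.
Qed.

(** The sums of two geometric series: the small scales have ratio 2^(sigma - 1) and need sigma < 1,
    the large ones have ratio 2^(-sigma) and need sigma > 0. The factors 2^N and 4^N come from the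
    volumes of the cubes. *)
Definition shell_cst : R :=
  2 ^+ N * 2 `^ a / (1 - 2 `^ (sigma - 1)) + 4 ^+ N / (1 - 2 `^ (- sigma)).

Lemma integral_shell_sum L x : 0 < L ->
  (\int[leb]_y (\sum_(0 <= k <oo) (shell L k (x - y))%:E) <= (shell_cst / L ^+ N)%:E)%E.
Proof.
move=> L0.
have mle rho : 0 <= rho ->
    measurable_fun setT (fun y : 'rV[R]_N => (L * `|x - y| <= rho)%R%:R : R) /\
    (\int[leb]_y ((L * `|x - y| <= rho)%R%:R : R)%:E = ((2 * (rho / L)) ^+ N)%:E)%E.
  move=> r0; have rL : 0 <= rho / L by rewrite divr_ge0// ltW.
  have cE (y : 'rV[R]_N) : (L * `|x - y| <= rho)%R%:R = \1_(cell (rho / L) x) y :> R.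
    rewrite indicE /cell mulrC -ler_pdivlMr//.
    case: (boolP (_ <= _)) => H; first by rewrite mem_set.
    by rewrite memNset//=; apply/negP.
  split.
    under eq_fun do rewrite cE.
    exact: measurable_indic (measurable_cell _ rL).
  under eq_integral do rewrite cE.
  have mc := measurable_cell x rL; rewrite integral_indic// setIT; exact: lebesgue_cell.
have h1 k : 0 <= 2^-1 ^+ k :> R by rewrite exprn_ge0.
have h2 k : 0 <= 2 ^+ k :> R by rewrite exprn_ge0.
pose f1 k (y : 'rV[R]_N) : R := 2^-1 ^+ k * (2 `^ a) ^+ k.+1 * (L * `|x - y| <= 2^-1 ^+ k)%R%:R.
pose f2 k (y : 'rV[R]_N) : R := (2 `^ (- a)) ^+ k * (L * `|x - y| <= 2 ^+ k.+1)%R%:R.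
have f10 k y : (0 <= (f1 k y)%:E)%E by rewrite lee_fin !mulr_ge0 ?exprn_ge0 ?powR_ge0.
have f20 k y : (0 <= (f2 k y)%:E)%E by rewrite lee_fin !mulr_ge0 ?exprn_ge0 ?powR_ge0.
have mf1 k : measurable_fun setT (f1 k) by apply: measurable_funM => //; exact: (mle _ (h1 k)).1.
have mf2 k : measurable_fun setT (f2 k) by apply: measurable_funM => //; exact: (mle _ (h2 k.+1)).1.
have if1 k : (\int[leb]_y (f1 k y)%:E = (2 ^+ N * 2 `^ a / L ^+ N * (2 `^ (sigma - 1)) ^+ k)%:E)%E.
  have [mk ik] := mle _ (h1 k).
  have c0 : 0 <= 2^-1 ^+ k * (2 `^ a) ^+ k.+1 :> R by rewrite mulr_ge0 ?exprn_ge0 ?powR_ge0.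
  rewrite (ge0_integral_scale _ mk (fun=> ler0n _ _) c0) ik; rewrite -EFinM; congr EFin.
  have -> : (2 * (2^-1 ^+ k / L)) ^+ N = 2 ^+ N * (2^-1 ^+ N) ^+ k / L ^+ N.
    by rewrite exprMn expr_div_n -!exprM mulnC mulrA.
  have -> : 2 `^ (sigma - 1) = 2^-1 * 2 `^ a * 2^-1 ^+ N.
    rewrite powRB ?pnatr_eq0 ?implybT// powRr1// powRD ?pnatr_eq0 ?implybT// powR_mulrn//.
    have E : 2 ^+ N * 2^-1 ^+ N = 1 :> R by rewrite -exprMn mulfV// expr1n.
    rewrite [RHS](_ : _ = 2 `^ sigma / 2 * (2 ^+ N * 2^-1 ^+ N)); last by ring.
    by rewrite E mulr1.
  by rewrite !exprMn exprS; ring.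
have if2 k : (\int[leb]_y (f2 k y)%:E = (4 ^+ N / L ^+ N * (2 `^ (- sigma)) ^+ k)%:E)%E.
  have [mk ik] := mle _ (h2 k.+1).
  have c0 : 0 <= (2 `^ (- a)) ^+ k :> R by rewrite exprn_ge0 ?powR_ge0.
  rewrite (ge0_integral_scale _ mk (fun=> ler0n _ _) c0) ik; rewrite -EFinM; congr EFin.
  have -> : (2 * (2 ^+ k.+1 / L)) ^+ N = 4 ^+ N * (2 ^+ N) ^+ k / L ^+ N.
    rewrite (_ : 2 * _ = 4 * (2 ^+ k / L)); last by rewrite exprS; ring.
    by rewrite exprMn expr_div_n -!exprM mulnC mulrA.
  have -> : 2 `^ (- sigma) = 2 `^ (- a) * 2 ^+ N.
    by rewrite -powR_mulrn// -powRD ?pnatr_eq0 ?implybT//; congr powR; ring.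
  by rewrite !exprMn; ring.
have q1 : 2 `^ (sigma - 1) < 1 :> R by rewrite powR2_lt1// subr_lt0.
have q2 : 2 `^ (- sigma) < 1 :> R by rewrite powR2_lt1// oppr_lt0.
rewrite integral_nneseries//; last 2 first.
- move=> k; apply/measurable_EFinP/measurable_funD; [exact: mf1|exact: mf2].
- by move=> k y _; rewrite lee_fin shell_ge0.
have -> : (\sum_(0 <= k <oo) \int[leb]_y (shell L k (x - y))%:E =
    \sum_(0 <= k <oo) ((2 ^+ N * 2 `^ a / L ^+ N * (2 `^ (sigma - 1)) ^+ k)%:E +
      (4 ^+ N / L ^+ N * (2 `^ (- sigma)) ^+ k)%:E))%E.
  apply: eq_eseriesr => k _; rewrite -if1 -if2 -ge0_integralD//.
  - by apply/measurable_EFinP; exact: mf1.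
  - by apply/measurable_EFinP; exact: mf2.
have LN0 : 0 < L ^+ N by rewrite exprn_gt0.
rewrite nneseriesD; last 2 first.
- by move=> k _; rewrite lee_fin mulr_ge0 ?divr_ge0 ?mulr_ge0 ?exprn_ge0 ?powR_ge0// ltW.
- by move=> k _; rewrite lee_fin mulr_ge0 ?divr_ge0 ?mulr_ge0 ?exprn_ge0 ?powR_ge0// ltW.
rewrite (_ : shell_cst / L ^+ N = 2 ^+ N * 2 `^ a / L ^+ N / (1 - 2 `^ (sigma - 1)) +
  4 ^+ N / L ^+ N / (1 - 2 `^ (- sigma))); last by rewrite /shell_cst; ring.
rewrite EFinD; apply: leeD; apply: geometric_nneseries_le => //.
- by rewrite divr_ge0 ?mulr_ge0 ?exprn_ge0 ?powR_ge0// ltW.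
- by rewrite divr_ge0 ?exprn_ge0// ltW.
Qed.

Lemma shell_cst_ge0 : 0 <= shell_cst.
Proof.
have q1 : 2 `^ (sigma - 1) < 1 :> R by rewrite powR2_lt1// subr_lt0.
have q2 : 2 `^ (- sigma) < 1 :> R by rewrite powR2_lt1// oppr_lt0.
by rewrite addr_ge0// divr_ge0 ?mulr_ge0 ?exprn_ge0 ?powR_ge0// subr_ge0 ltW.
Qed.

Lemma measurable_kern_sub L x : measurable_fun setT (fun y : 'rV[R]_N => kern L (x - y)).
Proof.
apply: (measurableT_comp (measurable_kern L)).
exact: (measurableT_comp measurable_sub_rV (pair1_measurable x)).
Qed.

Lemma measurable_shell L k : measurable_fun setT (shell L k).
Proof.
have mb rho : measurable_fun setT (fun h : 'rV[R]_N => (L * `|h| <= rho)%R%:R : R).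
  have mB : measurable_fun setT (fun h : 'rV[R]_N => L * `|h| <= rho).
    apply: measurable_fun_ler => //; apply: measurable_funM => //; exact: measurable_norm_rV.
  exact: (measurableT_comp (f := fun b : bool => b%:R : R)).
by apply: measurable_funD; apply: measurable_funM.
Qed.

(** The factor L^a of the shell bound meets L^(-N) from the volumes and leaves L^sigma. With L of
    order 1/eps on a slab of width of order eps, this is the source of eps^(1 - sigma). *)
Lemma integral_kern_le L x : 0 < L ->
  (\int[leb]_y (kern L (x - y))%:E <= (shell_cst * L `^ sigma)%:E)%E.
Proof.
move=> L0.
pose T (y : 'rV[R]_N) := (\sum_(0 <= k <oo) (shell L k (x - y))%:E)%E.
have T0 y : (0 <= T y)%E by apply: nneseries_ge0 => k _ _; rewrite lee_fin shell_ge0.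
have mT : measurable_fun setT T.
  apply: ge0_emeasurable_sum => [k y _ _|k _]; first by rewrite lee_fin shell_ge0.
  apply/measurable_EFinP; apply: (measurableT_comp (measurable_shell L k)).
  exact: (measurableT_comp measurable_sub_rV (pair1_measurable x)).
apply: (@le_trans _ _ (\int[leb]_y ((L `^ a)%:E * T y))%E).
  apply: ge0_le_integralT.
  - by apply/measurable_EFinP; exact: measurable_kern_sub.
  - exact: measurable_funeM.
  - by move=> y; rewrite lee_fin kern_ge0// ltW.
  - by move=> y; exact: kern_le_shell.
rewrite (ge0_integralZl_EFin _ _ _ mT) ?powR_ge0//.
apply: (@le_trans _ _ ((L `^ a)%:E * (shell_cst / L ^+ N)%:E)%E).
  by apply: lee_wpmul2l; [rewrite lee_fin powR_ge0|exact: integral_shell_sum].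
rewrite -EFinM lee_fin powRD ?(gt_eqF L0) ?implybT// powR_mulrn ?(ltW L0)//.
rewrite le_eqVlt; apply/orP; left; apply/eqP; field.
by rewrite expf_eq0 (gt_eqF L0) andbF.
Qed.

Lemma double_kern_le (S : set 'rV[R]_N) L : measurable S -> 0 < L ->
  (\int[leb \x leb]_z (\1_S z.1 * kern L (z.1 - z.2))%:E <=
    (shell_cst * L `^ sigma)%:E * leb S)%E.
Proof.
move=> mS L0.
have mf : measurable_fun setT (fun z : 'rV[R]_N * 'rV[R]_N => (\1_S z.1 * kern L (z.1 - z.2))%:E).
  apply/measurable_EFinP/measurable_funM.
    exact: (measurableT_comp (measurable_indic mS) measurable_fst).
  exact: (measurableT_comp (measurable_kern L) measurable_sub_rV).
have k0 h : 0 <= kern L h by rewrite kern_ge0// ltW.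
have f0 (z : 'rV[R]_N * 'rV[R]_N) : (0 <= (\1_S z.1 * kern L (z.1 - z.2))%:E)%E.
  by rewrite lee_fin mulr_ge0.
have -> := fubini_tonelli1 (m1 := leb) (m2 := leb) _ mf f0.
apply: (@le_trans _ _ (\int[leb]_x ((shell_cst * L `^ sigma) * \1_S x)%:E)%E).
  apply: ge0_le_integralT.
  - exact: (measurable_fun_fubini_tonelli_F _ mf f0).
  - by apply/measurable_EFinP/measurable_funM => //; exact: measurable_indic.
  - by move=> x; apply: integral_ge0 => y _; exact: f0.
  - move=> x; rewrite /fubini_F/=.
    rewrite (ge0_integral_scale _ (measurable_kern_sub L x) (fun=> k0 _)) //.
    rewrite mulrC EFinM; apply: lee_wpmul2l; first by rewrite lee_fin.
    exact: integral_kern_le.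
have mI : measurable_fun setT (\1_S : 'rV[R]_N -> R) by exact: measurable_indic.
rewrite (ge0_integral_scale _ mI) //; last by rewrite mulr_ge0 ?powR_ge0 ?shell_cst_ge0.
by rewrite integral_indic// setIT.
Qed.

Lemma kernN L h : kern L (- h) = kern L h.
Proof.
rewrite /kern normrN; congr (_ / _ `^ _); rewrite /enorm; congr Num.sqrt.
by apply: eq_bigr => i _; rewrite mxE sqrrN.
Qed.

(** Tonelli in the opposite order and the evenness of the kernel exchange the two variables. *)
Lemma double_kern_swap_le (S : set 'rV[R]_N) L : measurable S -> 0 < L ->
  (\int[leb \x leb]_z (\1_S z.2 * kern L (z.1 - z.2))%:E <=
    (shell_cst * L `^ sigma)%:E * leb S)%E.
Proof.
move=> mS L0; apply: le_trans (double_kern_le mS L0).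
have k0 h : 0 <= kern L h by rewrite kern_ge0// ltW.
pose f (z : 'rV[R]_N * 'rV[R]_N) := (\1_S z.1 * kern L (z.1 - z.2))%:E.
pose g (z : 'rV[R]_N * 'rV[R]_N) := (\1_S z.2 * kern L (z.1 - z.2))%:E.
have mk : measurable_fun setT (fun z : 'rV[R]_N * 'rV[R]_N => kern L (z.1 - z.2)).
  exact: (measurableT_comp (measurable_kern L) measurable_sub_rV).
have mf : measurable_fun setT f.
  apply/measurable_EFinP/measurable_funM => //.
  exact: (measurableT_comp (measurable_indic mS) measurable_fst).
have mg : measurable_fun setT g.
  apply/measurable_EFinP/measurable_funM => //.
  exact: (measurableT_comp (measurable_indic mS) measurable_snd).
have f0 z : (0 <= f z)%E by rewrite lee_fin mulr_ge0.
have g0 z : (0 <= g z)%E by rewrite lee_fin mulr_ge0.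
have -> := fubini_tonelli1 (m1 := leb) (m2 := leb) _ mf f0.
have -> := fubini_tonelli2 (m1 := leb) (m2 := leb) _ mg g0.
rewrite le_eqVlt; apply/orP; left; apply/eqP; apply: eq_integral => x _.
apply: eq_integral => y _; rewrite /f /g/=.
by rewrite -kernN opprB.
Qed.

(* Since |u x - u y| <= 1, its p-th power is at most its first power: only the
   exponent sigma = s p < 1 of the kernel matters, and kern is integrable. *)
Lemma double_integral_le (p : R) (u : 'rV[R]_N -> R) k
    (S : 'I_k -> set 'rV[R]_N) (L : 'I_k -> R) :
  1 <= p -> measurable_fun setT u -> (forall j, measurable (S j)) -> (forall j, 0 < L j) ->
  (forall x y, `|u x - u y| <= 1) ->
  (forall x y, `|u x - u y| <=
    \sum_(j < k) (\1_(S j) x + \1_(S j) y) * Num.min (L j * `|x - y|) 1) ->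
  (\int[leb \x leb]_z (`|u z.1 - u z.2| `^ p / enorm (z.1 - z.2) `^ a)%:E <=
   \sum_(j < k) (2 * shell_cst * L j `^ sigma)%:E * leb (S j))%E.
Proof.
move=> p1 mu mS L0 u1 uS.
have k0 j h : 0 <= kern (L j) h by rewrite kern_ge0// ltW.
pose f j (z : 'rV[R]_N * 'rV[R]_N) := (\1_(S j) z.1 * kern (L j) (z.1 - z.2))%:E.
pose g j (z : 'rV[R]_N * 'rV[R]_N) := (\1_(S j) z.2 * kern (L j) (z.1 - z.2))%:E.
have mk j : measurable_fun setT (fun z : 'rV[R]_N * 'rV[R]_N => kern (L j) (z.1 - z.2)).
  exact: (measurableT_comp (measurable_kern (L j)) measurable_sub_rV).
have mf j : measurable_fun setT (f j).
  apply/measurable_EFinP/measurable_funM => //.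
  exact: (measurableT_comp (measurable_indic (mS j)) measurable_fst).
have mg j : measurable_fun setT (g j).
  apply/measurable_EFinP/measurable_funM => //.
  exact: (measurableT_comp (measurable_indic (mS j)) measurable_snd).
have f0 j z : (0 <= f j z)%E by rewrite lee_fin mulr_ge0.
have g0 j z : (0 <= g j z)%E by rewrite lee_fin mulr_ge0.
have fg0 j z : (0 <= f j z + g j z)%E by rewrite adde_ge0.
have mfg j : measurable_fun setT (fun z => f j z + g j z)%E by exact: emeasurable_funD.
apply: (@le_trans _ _ (\int[leb \x leb]_z \sum_(j < k) (f j z + g j z))%E).
  apply: ge0_le_integralT.
  - apply/measurable_EFinP; apply: measurable_funM.
      apply: measurable_norm_powR; apply: measurable_funB.
        exact: (measurableT_comp mu measurable_fst).
      exact: (measurableT_comp mu measurable_snd).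
    under eq_fun do rewrite -powRN.
    apply: (measurableT_comp (f := @powR R ^~ (- a))); first exact: measurable_powR.
    exact: (measurableT_comp (@measurable_enorm R N) measurable_sub_rV).
  - exact: emeasurable_sum.
  - by move=> z; rewrite lee_fin divr_ge0 ?powR_ge0.
  - move=> [x y]/=.
    have -> : (\sum_(j < k) (f j (x, y) + g j (x, y)) =
        ((\sum_(j < k) (\1_(S j) x + \1_(S j) y) * Num.min (L j * `|x - y|) 1) / enorm (x - y) `^ a)%:E)%E.
      rewrite mulr_suml -sumEFin; apply: eq_bigr => j _.
      by rewrite /f /g /= -EFinD -mulrDl /kern mulrA.
    rewrite lee_fin ler_wpM2r ?invr_ge0 ?powR_ge0//; apply: le_trans (uS x y).
    have := u1 x y; have := normr_ge0 (u x - u y); set t := `|_|.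
    rewrite le_eqVlt => /predU1P[<- _|t0 t1]; first by rewrite powR0// gt_eqF// (lt_le_trans ltr01).
    by rewrite ge1r_powR// t0.
rewrite ge0_integral_sum//.
apply: lee_sum => j _; rewrite ge0_integralD//.
rewrite (_ : 2 * _ * _ = shell_cst * L j `^ sigma + shell_cst * L j `^ sigma); last by ring.
rewrite EFinD ge0_muleDl ?lee_fin ?mulr_ge0 ?powR_ge0 ?shell_cst_ge0//.
by apply: leeD; [exact: double_kern_le|exact: double_kern_swap_le].
Qed.

End kernel.

(** * Test functions *)

Section test_function.
Context (R : realType) (N : nat) (m : 'I_N) (hm : m.+1 = N).
Variables (l : R) (n : nat) (eps : R).
Hypothesis l0 : 0 < l.
Hypothesis eps0 : 0 < eps.
Implicit Types (x y : 'rV[R]_N) (i : 'I_N).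

Local Notation r := (l * (n%:R + 1 / 2)).
Local Notation K := (expR 2 * 8 : R).
Local Notation leb := (lebesgue_rV R N).

Lemma r_gt0 : 0 < r.
Proof. by rewrite mulr_gt0// addr_ge0_gt0 ?divr_gt0. Qed.

(** The index runs from 0 to 2n, so subtracting n lists the heights of the hyperplanes that contain
    slits. *)
Definition center (j : 'I_(2 * n).+1) : R := l * (j%:R - n%:R).

(** [bump] vanishes beyond three times its scale, so the scale r/6 confines the support to |x_i| <=
    r/2, well inside the open cube of half-side r. *)
Definition outer x : R := \prod_(i < N) bump (r / 6) (x ord0 i).
Definition inner x : R := \prod_(j < (2 * n).+1) (1 - bump eps (x ord0 m - center j)).
Definition test x : R := outer x * inner x.

Lemma dist_01 (a b : R) : 0 <= a <= 1 -> 0 <= b <= 1 -> `|a - b| <= 1.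
Proof. by move=> /andP[? ?] /andP[? ?]; rewrite ler_norml; apply/andP; split; lra. Qed.

Lemma mulr_diff (a b c d : R) : a * b - c * d = d * (a - c) + a * (b - d).
Proof. by ring. Qed.

Lemma prod_01 (k : nat) (f : 'I_k -> R) : (forall j, 0 <= f j <= 1) ->
  0 <= \prod_(j < k) f j <= 1.
Proof.
move=> f01; rewrite prodr_ge0/=; last by move=> j _; case/andP: (f01 j).
by apply: prodr_ile1 => j _; exact: f01.
Qed.

(** Exchange one factor at a time; the remaining factors have absolute value at most 1. *)
Lemma prod_lip (k : nat) (f g : 'I_k -> R) :
  (forall j, 0 <= f j <= 1) -> (forall j, 0 <= g j <= 1) ->
  `|\prod_(j < k) f j - \prod_(j < k) g j| <= \sum_(j < k) `|f j - g j|.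
Proof.
elim: k f g => [|k IH] f g f01 g01; first by rewrite !big_ord0 subrr normr0.
rewrite !big_ord_recl; set F := \prod_(i < k) _; set G := \prod_(i < k) _.
have -> : f ord0 * F - g ord0 * G = (f ord0 - g ord0) * F + g ord0 * (F - G) by ring.
apply: le_trans (ler_normD _ _) _; rewrite !normrM; apply: lerD.
  have /andP[F0 F1] : 0 <= F <= 1 by apply: prod_01.
  by rewrite ler_piMr// ger0_norm.
apply: le_trans (IH _ _ _ _) => //; case/andP: (g01 ord0) => g0 g1.
by rewrite ler_piMl// ger0_norm.
Qed.

Lemma bump01 (rho t : R) : 0 <= bump rho t <= 1.
Proof. by rewrite bump_ge0 bump_le1. Qed.

Lemma onem_bump01 (rho t : R) : 0 <= 1 - bump rho t <= 1.
Proof. by have /andP[? ?] := bump01 rho t; apply/andP; split; lra. Qed.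

Lemma outer01 x : 0 <= outer x <= 1.
Proof. by apply: prod_01 => i; exact: bump01. Qed.

Lemma inner01 x : 0 <= inner x <= 1.
Proof. by apply: prod_01 => i; exact: onem_bump01. Qed.

Lemma test01 x : 0 <= test x <= 1.
Proof.
have /andP[? ?] := outer01 x; have /andP[? ?] := inner01 x.
by rewrite mulr_ge0// mulr_ile1.
Qed.

Lemma smooth_expr_test c : smooth_expr (fun x => c * test x).
Proof.
apply: smooth_exprZ; apply: smooth_exprM.
  by apply: smooth_expr_prod => i; apply: smooth_expr_bump; exact: smooth_expr_coord.
apply: smooth_expr_prod => j.
apply: smooth_exprD; first exact: smooth_expr_cst.
under eq_fun do rewrite -mulN1r.
apply: smooth_exprZ; apply: smooth_expr_bump.
by apply: smooth_exprD; [exact: smooth_expr_coord|exact: smooth_expr_cst].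
Qed.

Lemma outer_neq0 x i : outer x != 0 -> `|x ord0 i| <= r / 2.
Proof.
move=> /prodf_neq0/(_ i isT); apply: contraNT; rewrite -ltNge => H.
have r0 := r_gt0; rewrite bump_eq0 ?divr_gt0//; lra.
Qed.

Lemma inner_neq0 x j : inner x != 0 -> eps <= `|x ord0 m - center j|.
Proof.
move=> /prodf_neq0/(_ j isT); apply: contraNT; rewrite -ltNge => H.
by rewrite bump_eq1// ?subrr// ltW.
Qed.

Lemma closure_le (f : 'rV[R]_N -> R) (A : set 'rV[R]_N) (c : R) : continuous f ->
  (forall x, A x -> f x <= c) -> forall x, closure A x -> f x <= c.
Proof.
move=> cf H x; have cl : closed (f @^-1` [set t | t <= c]).
  by apply: closed_comp => [y _|]; [exact: cf|exact: closed_le].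
move=> Ax; suff : (f @^-1` [set t | t <= c]) x by [].
by rewrite ((closure_id _).1 cl); move: Ax; apply: closure_subset => y /H.
Qed.

Lemma continuous_coord_sub i (c : R) : continuous (fun x => `|x ord0 i - c|).
Proof.
move=> x; apply: (@continuous_comp _ _ _ (fun x : 'rV[R]_N => x ord0 i - c) Num.norm).
  exact: (cvgB (@coord_continuous _ _ _ ord0 i x) (cvg_cst c)).
exact: norm_continuous.
Qed.

(** Both conditions are closed, so they survive the closure in the definition of [supp]; the margins
    r/2 and [eps] then keep the support inside the open domain. *)
Lemma supp_test c x : supp (fun x => c * test x) x ->
  (forall i, `|x ord0 i| <= r / 2) /\ (forall j, eps <= `|x ord0 m - center j|).
Proof.
move=> sx; have nz y : c * test y != 0 -> outer y != 0 /\ inner y != 0.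
  by rewrite mulf_eq0 negb_or mulf_eq0 negb_or => /and3P[].
split=> [i|j].
  rewrite -[X in `|X|]subr0; move: x sx; apply: closure_le; first exact: continuous_coord_sub.
  by move=> y /nz[/(outer_neq0 i)]; rewrite subr0.
rewrite -lerN2; move: x sx; apply: (@closure_le (fun x => - `|x ord0 m - center j|)).
  by move=> y; exact: (cvgN (@continuous_coord_sub m (center j) y)).
by move=> y /nz[_ /(inner_neq0 j)]; rewrite lerN2.
Qed.

Lemma Cc_smooth_test c : Cc_smooth (dom l n) (fun x => c * test x).
Proof.
split.
- exact/smooth_expr_smooth/smooth_expr_test.
- apply: (@subclosed_compact _ _ [set x : 'rV[R]_N | forall i, `[- (r / 2), r / 2]%classic (x ord0 i)]).
  + exact: closed_closure.
  + by apply: (@rV_compact R N (fun=> `[- (r / 2), r / 2]%classic)) => i; exact: segment_compact.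
  + by move=> x /supp_test[H _] i; rewrite /= in_itv/= -ler_norml.
- move=> x /supp_test[H1 H2]; apply: (mem_dom hm l0).
    by move=> i; have := H1 i; have := r_gt0; lra.
  move=> k kn; apply/negP => /eqP xk.
  (* The hyperplane at height l k is the one with index k + n. *)
  have kn' : (absz (k + n%:Z)%R < (2 * n).+1)%N by lia.
  have := H2 (Ordinal kn'); rewrite /center/= xk leNgt => /negP; apply.
  have -> : ((absz (k + n%:Z)%R)%:R : R) = k%:~R + n%:R.
    by rewrite natr_absz ger0_norm ?intrD//; lia.
  by rewrite -mulrBr [X in l * X](_ : _ = 0) ?mulr0 ?normr0//; ring.
Qed.

Definition outer_box : set 'rV[R]_N := box (fun=> `[- (r / 2), r / 2]%classic).

(** The half-width 3 eps covers the whole support of the bump of scale [eps]; cutting by [outer_box]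
    makes the volume finite. *)
Definition slab (j : 'I_(2 * n).+1) : set 'rV[R]_N := box (fun i =>
  if i == m then `[center j - 3 * eps, center j + 3 * eps]%classic
  else `[- (r / 2), r / 2]%classic).

Lemma measurable_outer_box : measurable outer_box.
Proof. by apply: measurable_box => i; exact: measurable_itv. Qed.

Lemma measurable_slab j : measurable (slab j).
Proof. by apply: measurable_box => i; case: ifPn => _; exact: measurable_itv. Qed.

Lemma lebesgue_sym_itv (c rho : R) : 0 <= rho ->
  lebesgue_measure (`[c - rho, c + rho]%classic : set R) = (2 * rho)%:E.
Proof.
move=> r0; rewrite lebesgue_measure_itv/= lte_fin -EFinD.
case: ifPn => [_|]; first by congr EFin; ring.
by rewrite -leNgt => H; congr EFin; lra.
Qed.

Lemma lebesgue_sym_itv0 (rho : R) : 0 <= rho ->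
  lebesgue_measure (`[- rho, rho]%classic : set R) = (2 * rho)%:E.
Proof. by move=> r0; have := lebesgue_sym_itv 0 r0; rewrite !add0r. Qed.

Lemma lebesgue_slab_box (c e rho : R) : 0 <= rho -> 0 <= e ->
  leb (box (fun i => if i == m then `[c - e, c + e]%classic else `[- rho, rho]%classic)) =
  (2 * e * (2 * rho) ^+ N.-1)%:E.
Proof.
move=> r0 e0; rewrite lebesgue_rV_box; last by move=> i; case: ifPn => _; exact: measurable_itv.
rewrite (bigD1 m)//= eqxx lebesgue_sym_itv//.
rewrite (eq_bigr (fun=> (2 * rho)%:E)); last first.
  by move=> i im; rewrite (negbTE im) lebesgue_sym_itv0.
rewrite prodEFin prodr_const -EFinM; congr (_ * _ ^+ _)%:E.
by rewrite (eq_card (B := predC1 m)) ?cardC1 ?card_ord// => i; rewrite !inE.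
Qed.

Lemma lebesgue_cube_box (rho : R) : 0 <= rho ->
  leb (box (fun=> `[- rho, rho]%classic)) = ((2 * rho) ^+ N)%:E.
Proof.
move=> r0; rewrite lebesgue_rV_box; last by move=> i; exact: measurable_itv.
under eq_bigr do rewrite lebesgue_sym_itv0//.
by rewrite prodEFin prodr_const card_ord.
Qed.

Lemma lebesgue_outer_box : leb outer_box = (r ^+ N)%:E.
Proof.
have r0 := r_gt0; rewrite lebesgue_cube_box ?divr_ge0 ?ltW//.
by rewrite mulrC divfK.
Qed.

Lemma lebesgue_slab j : leb (slab j) = (6 * eps * r ^+ N.-1)%:E.
Proof.
have r0 := r_gt0; rewrite lebesgue_slab_box ?divr_ge0 ?mulr_ge0 ?ltW//.
by rewrite (mulrC 2 (r / 2)) divfK// mulrA -natrM.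
Qed.

Let L0_ge0 : 0 <= N%:R * (6 * K / r).
Proof. by rewrite mulr_ge0// divr_ge0 ?mulr_ge0 ?expR_ge0// ltW// r_gt0. Qed.

Let c_ge0 : 0 <= 6 * K / r.
Proof. by rewrite divr_ge0 ?mulr_ge0 ?expR_ge0// ltW// r_gt0. Qed.

Let L1_ge0 : 0 <= K / eps.
Proof. by rewrite divr_ge0 ?mulr_ge0 ?expR_ge0// ltW. Qed.

Let subr_onem (a b : R) : 1 - a - (1 - b) = b - a. Proof. by ring. Qed.

Let outerP x : x \notin outer_box -> outer x = 0.
Proof.
move=> xo; apply/eqP/negPn/negP => ox; move/negP: xo; apply; rewrite inE => i.
by rewrite /= in_itv/= -ler_norml; exact: outer_neq0.
Qed.

(** If both points are outside the box both values are 0; otherwise the indicators add up to at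
    least 1. The slope is that of [bump] at scale r/6, once for each of the N coordinates. *)
Lemma outer_lip x y : `|outer x - outer y| <=
  (\1_outer_box x + \1_outer_box y) * Num.min (N%:R * (6 * K / r) * `|x - y|) 1.
Proof.
have r0 := r_gt0.
have [xo|/[dup] xo /outerP ox] := boolP (x \in outer_box); last first.
  have [yo|/[dup] yo /outerP oy] := boolP (y \in outer_box); last first.
    rewrite ox oy subrr normr0 mulr_ge0 ?addr_ge0// le_min ler01 andbT.
    by rewrite mulr_ge0.
all: apply: (@le_trans _ _ (Num.min (N%:R * (6 * K / r) * `|x - y|) 1)).
all: try by rewrite ler_peMl ?indicE ?xo ?yo ?lerDl ?lerDr// le_min ler01 andbT mulr_ge0.
all: rewrite le_min; apply/andP; split; last first.
all: try exact: dist_01 (outer01 x) (outer01 y).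
all: apply: le_trans (prod_lip _ _) _ => [i|i|]; try exact: bump01.
all: apply: (@le_trans _ _ (\sum_(i < N) (6 * K / r * `|x - y|))); last
  by rewrite sumr_const card_ord -[leLHS]mulr_natl -(mulrA N%:R).
all: apply: ler_sum => i _; apply: le_trans (bump_lip _ _ _) _; rewrite ?divr_gt0//.
all: rewrite (_ : K / (r / 6) = 6 * K / r); last by (field; rewrite ?gt_eqF).
all: by rewrite ler_wpM2l ?c_ge0//;
  apply: le_trans (le_norm_coord _ i); rewrite !mxE.
Qed.

(** The slabs are truncated, so a point close to a hyperplane is known to lie in a slab only where
    [outer] does not vanish. *)
Lemma inner_lip x y : outer x != 0 -> outer y != 0 ->
  `|inner x - inner y| <=
  \sum_(j < (2 * n).+1) (\1_(slab j) x + \1_(slab j) y) * Num.min (K / eps * `|x - y|) 1.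
Proof.
move=> ox oy.
have slabP j z : outer z != 0 -> z \notin slab j -> bump eps (z ord0 m - center j) = 0.
  move=> oz zj; apply: bump_eq0 => //; rewrite leNgt; apply/negP => H.
  move/negP: zj; apply; rewrite inE => i; case: ifPn => [/eqP ->|_] /=; rewrite in_itv/=.
    by rewrite -ler_distl ltW.
  by rewrite -ler_norml; exact: outer_neq0.
apply: le_trans (prod_lip _ _) _ => [j|j|]; try exact: onem_bump01.
apply: ler_sum => j _.
rewrite subr_onem.
have M0 : 0 <= Num.min (K / eps * `|x - y|) 1.
  by rewrite le_min ler01 andbT mulr_ge0.
have main : `|bump eps (y ord0 m - center j) - bump eps (x ord0 m - center j)| <=
    Num.min (K / eps * `|x - y|) 1.
  rewrite le_min; apply/andP; split; last first.
    exact: dist_01 (bump01 _ _) (bump01 _ _).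
  apply: le_trans (bump_lip _ _ eps0) _; rewrite ler_wpM2l//.
  rewrite distrC (_ : _ - _ = (x - y) ord0 m); last by rewrite !mxE; ring.
  exact: le_norm_coord.
have [xo|/[dup] xo /(slabP j _ ox) bx] := boolP (x \in slab j); last first.
  have [yo|/[dup] yo /(slabP j _ oy) yx] := boolP (y \in slab j); last first.
    by rewrite bx yx subrr normr0 mulr_ge0// addr_ge0.
all: by apply: le_trans main _; rewrite ler_peMl// !indicE ?xo ?yo ?lerDl ?lerDr.
Qed.

Lemma test_lip x y : `|test x - test y| <=
  (\1_outer_box x + \1_outer_box y) * Num.min (N%:R * (6 * K / r) * `|x - y|) 1 +
  \sum_(j < (2 * n).+1) (\1_(slab j) x + \1_(slab j) y) * Num.min (K / eps * `|x - y|) 1.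
Proof.
have S0 a b : 0 <= \sum_(j < (2 * n).+1)
    (\1_(slab j) a + \1_(slab j) b) * Num.min (K / eps * `|a - b|) 1.
  apply: sumr_ge0 => j _; rewrite mulr_ge0 ?addr_ge0// le_min ler01 andbT.
  by rewrite mulr_ge0.
(* In the splitting used below, the difference of [inner] is weighted by [outer x]. With this order,
   either that weight is 0 or both values of [outer] are nonzero, as [inner_lip] requires. *)
wlog oxy : x y / outer x <= outer y.
  move=> H; have [xy|/ltW yx] := leP (outer x) (outer y); first exact: H.
  rewrite distrC; apply: le_trans (H _ _ yx) _; rewrite (distrC y) (addrC (\1_outer_box y)).
  by rewrite lerD2l; apply: ler_sum => j _; rewrite (addrC (\1_(slab j) y)).
rewrite /test.
rewrite mulr_diff.
have /andP[i0 i1] := inner01 y; have /andP[u0 u1] := outer01 x.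
apply: le_trans (ler_normD _ _) _; rewrite !normrM (ger0_norm i0) (ger0_norm u0).
apply: lerD; first by apply: le_trans (outer_lip x y); rewrite ler_piMl.
have [->|ox] := eqVneq (outer x) 0; first by rewrite mul0r.
have ox' : 0 < outer x by rewrite lt_def ox u0.
have oy : outer y != 0 by exact: lt0r_neq0 (lt_le_trans ox' oxy).
by apply: le_trans (inner_lip ox oy); rewrite ler_piMl.
Qed.

End test_function.

(** * Normalized test functions and Rayleigh quotients *)

Section normalization.
Context (R : realType) (N : nat) (s p : R).
Hypothesis p1 : 1 < p.
Local Notation leb := (lebesgue_rV R N).

Let p0 : 0 < p. Proof. exact: lt_trans ltr01 p1. Qed.

Lemma gagliardo_poweR (u : 'rV[R]_N -> R) : (gagliardo s p u `^ p =
  \int[leb \x leb]_z (`|u z.1 - u z.2| `^ p / enorm (z.1 - z.2) `^ (N%:R + s * p))%:E)%E.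
Proof.
rewrite /gagliardo -poweRrM mulVf ?gt_eqF// poweRe1//.
by apply: integral_ge0 => z _; rewrite lee_fin divr_ge0 ?powR_ge0.
Qed.

Lemma Lp_norm_eq1 (A : set 'rV[R]_N) (u : 'rV[R]_N -> R) : (forall x, u x != 0 -> A x) ->
  (\int[leb]_x (`|u x| `^ p)%:E = 1)%E -> Lp_norm A p u = 1%E.
Proof.
move=> uA; rewrite -(Lp_norm_poweR (lt0r_neq0 p0) uA) => H.
rewrite -[LHS]poweRe1 ?Lnorm_ge0// -[X in (_ `^ X)%E](mulfV (lt0r_neq0 p0)) poweRrM H.
by rewrite poweR_EFin powR1.
Qed.

Variables (A : set 'rV[R]_N) (u : 'rV[R]_N -> R) (W : R).
Hypothesis uA : forall c, Cc_smooth A (fun x => c * u x).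
Hypothesis mu : measurable_fun setT u.
Hypothesis W0 : 0 < W.
Hypothesis uW : (\int[leb]_x (`|u x| `^ p)%:E = W%:E)%E.

Definition normalized x := W `^ (- p^-1) * u x.

Let cp : `|W `^ (- p^-1)| `^ p = W^-1.
Proof. by rewrite ger0_norm ?powR_ge0// -powRrM mulNr mulVf ?gt_eqF// powR_inv1// ltW. Qed.

Lemma normalized_admissible : Cc_smooth A normalized /\ Lp_norm A p normalized = 1%E.
Proof.
split; first exact: uA.
apply: Lp_norm_eq1.
  by move=> x /neq0_supp; have [_ _] := uA (W `^ (- p^-1)); exact.
transitivity (\int[leb]_x (W^-1 * `|u x| `^ p)%:E)%E.
  by apply: eq_integral => x _; rewrite /normalized normrM powRM// cp.
rewrite ge0_integral_scale//; last 2 first.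
- exact: measurable_norm_powR.
- by rewrite invr_ge0 ltW.
by rewrite uW -EFinM mulVf ?gt_eqF.
Qed.

Lemma lambdas_le (E : R) :
  (\int[leb \x leb]_z (`|u z.1 - u z.2| `^ p / enorm (z.1 - z.2) `^ (N%:R + s * p))%:E <= E%:E)%E ->
  (lambdas s p A <= (E / W)%:E)%E.
Proof.
move=> HE; apply: (@le_trans _ _ (gagliardo s p normalized `^ p)%E).
  by apply: ereal_inf_lbound; exists normalized => //; exact: normalized_admissible.
rewrite gagliardo_poweR.
pose f (z : 'rV[R]_N * 'rV[R]_N) := `|u z.1 - u z.2| `^ p / enorm (z.1 - z.2) `^ (N%:R + s * p).
have mf : measurable_fun setT f.
  apply: measurable_funM.
    apply: measurable_norm_powR; apply: measurable_funB.
      exact: (measurableT_comp mu measurable_fst).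
    exact: (measurableT_comp mu measurable_snd).
  under eq_fun do rewrite -powRN.
  apply: (measurableT_comp (f := @powR R ^~ (- (N%:R + s * p)))); first exact: measurable_powR.
  exact: (measurableT_comp (@measurable_enorm R N) (@measurable_sub_rV R N)).
have f0 z : 0 <= f z by rewrite divr_ge0 ?powR_ge0.
have W0' : 0 <= W^-1 by rewrite invr_ge0 ltW.
have -> : (\int[leb \x leb]_z (`|normalized z.1 - normalized z.2| `^ p /
      enorm (z.1 - z.2) `^ (N%:R + s * p))%:E =
    \int[leb \x leb]_z (W^-1 * f z)%:E)%E.
  apply: eq_integral => z _; rewrite /normalized -mulrBr normrM powRM// cp.
  by rewrite /f mulrA.
rewrite (ge0_integral_scale _ mf f0 W0') mulrC EFinM; apply: lee_wpmul2l.
  by rewrite lee_fin.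
exact: HE.
Qed.

Lemma lambda1_lt_pinfty :
  (\int[leb]_x (`|enorm (grad normalized x)| `^ p)%:E < +oo)%E -> (lambda1 p A < +oo)%E.
Proof.
apply: le_lt_trans.
apply: (@le_trans _ _ (Lp_norm A p (fun x => enorm (grad normalized x)) `^ p)%E).
  by apply: ereal_inf_lbound; exists normalized => //; exact: normalized_admissible.
rewrite Lp_norm_poweR ?gt_eqF// => x /grad_supp.
by have [[_ _]] := normalized_admissible => + _; exact.
Qed.

End normalization.

(** * Energy and mass of the test function *)

Section energy.
Lemma slab_arith (F : comRingType) (C K r e rm rp ep : F) :
  2 * C * (K * (rp * ep)) * (6 * (r * e) * rm) = 12 * C * K * (r * rm * rp) * (e * ep).
Proof. by ring. Qed.

Lemma holes_arith (F : comRingType) (M r e rm : F) :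
  M * (6 * (r * e) * rm) = 6 * r * rm * (M * e).
Proof. by ring. Qed.

Lemma sixth_arith (F : realFieldType) (r rm : F) : 6 * r * rm * (1 / 36) = r / 3 * rm / 2.
Proof. by field. Qed.

Lemma half_le (F : realFieldType) (a b c : F) : c <= a + b -> b <= c / 2 -> c / 2 <= a.
Proof. by lra. Qed.

Lemma energy_arith (F : comRingType) (C a b rn rp : F) :
  (2 * C * a + 12 * C * b) * (rn * rp) = 2 * C * (a * rp) * rn + 12 * C * b * (rn * rp).
Proof. by ring. Qed.

Context (R : realType) (N : nat) (m : 'I_N) (hm : m.+1 = N).
Variables (l : R) (n : nat) (p : R) (sigma : R).
Hypothesis l0 : 0 < l.
Hypothesis p1 : 1 < p.
Hypothesis sigma0 : 0 < sigma.
Hypothesis sigma1 : sigma < 1.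
Local Notation leb := (lebesgue_rV R N).
Local Notation r := (l * (n%:R + 1 / 2)).
Local Notation K := (expR 2 * 8 : R).
Local Notation M := ((2 * n).+1%:R : R).
Local Notation C := (shell_cst N sigma).

(* The relative half-width of the slabs makes both (2 n + 1) * eta and
   (2 n + 1) * eta^(1 - sigma) at most 1. *)
Definition eta : R := M `^ (- (1 - sigma)^-1) / 36.
Local Notation eps := (r * eta).
Local Notation u := (@test R N m l n eps).

Let r0 : 0 < r := r_gt0 n l0.

Let s1 : 0 < 1 - sigma. Proof. by rewrite subr_gt0. Qed.

Lemma eta_gt0 : 0 < eta.
Proof. by rewrite divr_gt0// powR_gt0. Qed.

Let eps0 : 0 < eps. Proof. by rewrite mulr_gt0// eta_gt0. Qed.

(** The exponent of the product is 1 - 1/(1 - sigma) <= 0. The 1/36 serves the mass: the slabs have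
    total width 6 r M eta <= r/6, half the side of the inner cube. *)
Lemma M_eta : M * eta <= 1 / 36.
Proof.
rewrite /eta mulrA ler_pM2r// -[X in X * _]powRr1// -powRD ?pnatr_eq0 ?implybT//.
rewrite -[leRHS](powRr0 M); apply: ler_powR; first by rewrite ler1n.
by rewrite subr_le0 invf_ge1// lerBlDr lerDl ltW.
Qed.

(** This dictates the exponent in [eta]: each slab has energy proportional to eta^(1 - sigma), and
    the sum of 2n+1 of them must not depend on n. *)
Lemma M_eta_powR : M * eta `^ (1 - sigma) <= 1.
Proof.
rewrite /eta powRM ?powR_ge0 ?invr_ge0// -powRrM mulNr mulVf ?gt_eqF// powR_inv1// mulrA.
rewrite mulfV ?pnatr_eq0// mul1r.
have e1 : 1 = 1 `^ (1 - sigma) :> R by rewrite powR1.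
rewrite [leRHS]e1; apply: ge0_ler_powR; rewrite ?nnegrE ?invr_ge0//.
  exact: ltW.
by rewrite invf_le1// ler1n.
Qed.

(** The first term is the outer cutoff, of slope 6 N K / r on a box of volume r^N. The second is all
    the slabs together; its 12 is the 2 of [double_integral_le] times the 6 of the slab width. *)
Definition energy_cst : R :=
  2 * C * (N%:R * (6 * K)) `^ sigma + 12 * C * K `^ sigma.

Lemma energy_le :
  (\int[leb \x leb]_z (`|u z.1 - u z.2| `^ p / enorm (z.1 - z.2) `^ (N%:R + sigma))%:E <=
   (energy_cst * (r ^+ N * r `^ (- sigma)))%:E)%E.
Proof.
have C0 := @shell_cst_ge0 R N sigma sigma0 sigma1.
have K0 : 0 < K by rewrite mulr_gt0 ?expR_gt0.
(* Index 0 stands for the outer cutoff, the other indices for the slabs. *)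
pose S (j : 'I_(2 * n).+2) := if unlift ord0 j is Some j' then slab m l eps j' else @outer_box R N l n.
pose L (j : 'I_(2 * n).+2) := if unlift ord0 j is Some j' then K / eps else N%:R * (6 * K / r).
have N0 : 0 < N%:R :> R by rewrite ltr0n -hm.
have mu : measurable_fun setT u.
  apply: continuous_measurable_rV; have := @smooth_expr_test R N m l n eps 1.
  under eq_fun do rewrite mul1r.
  exact: continuous_smooth_expr.
have H := @double_integral_le R N sigma sigma0 sigma1 p u (2 * n).+2 S L (ltW p1) mu.
apply: le_trans (H _ _ _ _) _ => {H}.
- move=> j; rewrite /S; case: (unlift _ _) => [j'|]; first exact: measurable_slab.
  exact: measurable_outer_box.
- move=> j; rewrite /L; case: (unlift _ _) => [_|]; first by rewrite divr_gt0.
  by rewrite mulr_gt0// divr_gt0// mulr_gt0.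
- by move=> x y; apply: dist_01; exact: test01.
- move=> x y; rewrite big_ord_recl /S /L unlift_none.
  under eq_bigr do rewrite liftK.
  exact: test_lip.
rewrite big_ord_recl /S /L unlift_none.
under eq_bigr do rewrite liftK.
have Vp (t b : R) : 0 < t -> t^-1 `^ b = t `^ (- b).
  by move=> t0; rewrite -powR_inv1 ?(ltW t0)// -powRrM mulN1r.
have rN : r ^+ N = r * r ^+ N.-1 by rewrite -exprS prednK// -hm.
have e0 := eta_gt0.
(* Since eps = r eta, the product of eps^(-sigma), eps and r^(N-1) is r^(N - sigma) eta^(1 -
   sigma). *)
have slabE (j : 'I_(2 * n).+1) : ((2 * C * (K / eps) `^ sigma)%:E * leb (slab m l eps j) =
    (12 * C * K `^ sigma * (r ^+ N * r `^ (- sigma)) * eta `^ (1 - sigma))%:E)%E.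
  have -> := lebesgue_slab m l0 eps0 j.
  rewrite -EFinM; congr EFin.
  have Ve : 0 <= eps^-1 by rewrite invr_ge0 ltW.
  rewrite (powRM sigma (ltW K0) Ve) (Vp _ _ eps0) (powRM _ (ltW r0) (ltW e0)).
  rewrite powRD ?(gt_eqF e0) ?implybT// powRr1 ?(ltW e0)// rN.
  exact: slab_arith.
under eq_bigr do rewrite slabE.
have -> := lebesgue_outer_box N n l0.
rewrite sumEFin -EFinM -EFinD lee_fin sumr_const card_ord -[X in _ + X]mulr_natl.
have Vr : 0 <= r^-1 by rewrite invr_ge0 ltW.
have NK : 0 <= N%:R * (6 * K) by rewrite !mulr_ge0// ltW.
have -> : N%:R * (6 * K / r) = N%:R * (6 * K) * r^-1 by rewrite mulrA.
rewrite (powRM sigma NK Vr) (Vp _ _ r0).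
have B0 : 0 <= 12 * C * K `^ sigma * (r ^+ N * r `^ (- sigma)).
  by rewrite !mulr_ge0 ?powR_ge0 ?exprn_ge0 ?(ltW r0).
have -> : energy_cst * (r ^+ N * r `^ (- sigma)) =
  2 * C * ((N%:R * (6 * K)) `^ sigma * r `^ (- sigma)) * r ^+ N +
  12 * C * K `^ sigma * (r ^+ N * r `^ (- sigma)).
  exact: energy_arith.
rewrite lerD2l mulrCA ler_piMr//; exact: M_eta_powR.
Qed.

(** The test function equals 1 on the cube |x_i| <= r/6 outside the slabs. The cube has volume
    (r/3)^N, of which the slabs take at most half. *)
Lemma powR_integral_test : exists2 W : R,
  (\int[leb]_x (`|u x| `^ p)%:E = W%:E)%E & (r / 3) ^+ N / 2 <= W.
Proof.
have p0 : 0 < p by exact: lt_trans ltr01 p1.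
have mu : measurable_fun setT u.
  apply: continuous_measurable_rV; have := @smooth_expr_test R N m l n eps 1.
  under eq_fun do rewrite mul1r.
  exact: continuous_smooth_expr.
set W := (\int[leb]_x _)%E.
have W0 : (0 <= W)%E by apply: integral_ge0 => x _; rewrite lee_fin powR_ge0.
have Wfin : (W <= (r ^+ N)%:E)%E.
  rewrite -(lebesgue_outer_box N n l0).
  have mo := @measurable_outer_box R N l n.
  have -> : leb (@outer_box R N l n) = (\int[leb]_x (\1_(@outer_box R N l n) x)%:E)%E.
    by rewrite integral_indic// setIT.
  apply: ge0_le_integralT.
  - by apply/measurable_EFinP; exact: measurable_norm_powR.
  - by apply/measurable_EFinP; exact: measurable_indic.
  - by move=> x; rewrite lee_fin powR_ge0.
  - move=> x; rewrite lee_fin indicE; have /andP[u0 u1] := @test01 R N m l n eps x.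
    have [xo|xo] := boolP (x \in @outer_box R N l n).
      rewrite ger0_norm// -[leRHS](powRr0 (u x)).
      move: u0; rewrite le_eqVlt => /predU1P[<-|u0]; first by rewrite powR0 ?gt_eqF// powRr0.
      by apply: ger_powR; [rewrite u0 u1|exact: ltW].
    suff -> : u x = 0 by rewrite normr0 powR0 ?gt_eqF.
    rewrite /test; suff -> : outer l n x = 0 by rewrite mul0r.
    apply/eqP/negPn/negP => ox; move/negP: xo; apply; rewrite inE => i.
    by rewrite /= in_itv/= -ler_norml; exact: outer_neq0.
have Wf : W \is a fin_num by rewrite ge0_fin_numE// (le_lt_trans Wfin)// ltry.
exists (fine W); first by rewrite fineK.
rewrite -lee_fin fineK//.
pose P0 : set 'rV[R]_N := box (fun=> `[- (r / 6), r / 6]%classic).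
(* These slabs are cut by the smaller cube, so that their volume compares with (r/3)^N and not with
   r^N. *)
pose Sl (j : 'I_(2 * n).+1) : set 'rV[R]_N := box (fun i =>
  if i == m then `[center l j - 3 * eps, center l j + 3 * eps]%classic
  else `[- (r / 6), r / 6]%classic).
have mP0 : measurable P0 by apply: measurable_box => i; exact: measurable_itv.
have mSl j : measurable (Sl j).
  by apply: measurable_box => i; case: ifPn => _; exact: measurable_itv.
have r6 : 0 <= r / 6 by rewrite divr_ge0// ltW.
have e3 : 0 <= 3 * eps by rewrite mulr_ge0// ltW.
have vP0 : leb P0 = ((r / 3) ^+ N)%:E.
  by rewrite (lebesgue_cube_box N r6); congr (_ ^+ _)%:E; field.
have vSl j : leb (Sl j) = (6 * eps * (r / 3) ^+ N.-1)%:E.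
  rewrite (lebesgue_slab_box m (center l j) r6 e3); congr EFin; congr (_ * _ ^+ _).
    by rewrite mulrA -natrM.
  by field.
have iP0 : leb P0 = (\int[leb]_x (\1_P0 x)%:E)%E by rewrite integral_indic// setIT.
have iSl j : leb (Sl j) = (\int[leb]_x (\1_(Sl j) x)%:E)%E by rewrite integral_indic// setIT.
have key : (leb P0 <= W + \sum_(j < (2 * n).+1) leb (Sl j))%E.
  rewrite iP0; under eq_bigr do rewrite iSl.
  have mS j : measurable_fun setT (fun x : 'rV[R]_N => (\1_(Sl j) x : R)%:E).
    by apply/measurable_EFinP; exact: measurable_indic.
  rewrite -ge0_integral_sum//.
  rewrite -ge0_integralD//; last 3 first.
  - by apply/measurable_EFinP; exact: measurable_norm_powR.
  - by move=> x _; apply: sume_ge0 => j _; rewrite lee_fin.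
  - exact: emeasurable_sum.
  apply: ge0_le_integralT.
  - by apply/measurable_EFinP; exact: measurable_indic.
  - apply: emeasurable_funD; last exact: emeasurable_sum.
    by apply/measurable_EFinP; exact: measurable_norm_powR.
  - by move=> x; rewrite lee_fin.
  - move=> x; rewrite sumEFin -EFinD lee_fin.
    have [xP|xP] := boolP (x \in P0); last first.
      by rewrite indicE (negbTE xP) addr_ge0 ?powR_ge0// sumr_ge0.
    rewrite indicE xP.
    have [/existsP[j xj]|/existsPn nj] := boolP [exists j, x \in Sl j].
      rewrite (bigD1 j)//= indicE xj addrCA lerDl addr_ge0 ?powR_ge0//.
      by apply: sumr_ge0.
    suff -> : u x = 1 by rewrite normr1 powR1 lerDl sumr_ge0.
    have xr i : `|x ord0 i| <= r / 6.
      by move: xP; rewrite inE => /(_ i); rewrite /= in_itv/= ler_norml.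
    rewrite /test /outer /inner !big1 ?mulr1// => [j _|i _]; last first.
      by rewrite bump_eq1// divr_gt0.
    rewrite bump_eq0 ?subr0// leNgt; apply/negP => H.
    move/negP: (nj j); apply; rewrite inE => i; case: ifPn => [/eqP ->|_] /=; rewrite in_itv/=.
      by rewrite -ler_distl ltW.
    by rewrite -ler_norml.
move: key; rewrite vP0; under eq_bigr do rewrite vSl.
rewrite sumEFin sumr_const card_ord => key.
have rN : (r / 3) ^+ N = r / 3 * (r / 3) ^+ N.-1 by rewrite -exprS prednK// -hm.
have T : 6 * eps * (r / 3) ^+ N.-1 *+ (2 * n).+1 <= (r / 3) ^+ N / 2.
  rewrite rN -mulr_natl.
  have r3 : 0 <= (r / 3) ^+ N.-1 by rewrite exprn_ge0 ?divr_ge0// ltW.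
  have -> : M * (6 * eps * (r / 3) ^+ N.-1) = 6 * r * (r / 3) ^+ N.-1 * (M * eta).
    exact: holes_arith.
  apply: (@le_trans _ _ (6 * r * (r / 3) ^+ N.-1 * (1 / 36))).
    by rewrite ler_wpM2l ?M_eta// !mulr_ge0// ltW.
  by rewrite sixth_arith.
rewrite -(fineK Wf) lee_fin; move: key; rewrite -(fineK Wf) -EFinD lee_fin => key.
exact: half_le key T.
Qed.

End energy.

(** * Bounds on both constants *)

Section lambda1_finite.
Context (R : realType) (N : nat) (p : R).
Hypothesis p1 : 1 < p.
Local Notation leb := (lebesgue_rV R N).

Lemma Cc_smooth_grad_bounded (A : set 'rV[R]_N) (u : 'rV[R]_N -> R) : Cc_smooth A u ->
  exists2 B : R, 0 <= B & forall x, enorm (grad u x) <= B.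
Proof.
move=> [su cs _].
have cdu i : continuous (partial i u) by have [] := su [:: i].
have gz x : ~ supp u x -> enorm (grad u x) = 0.
  by move=> sx; apply/eqP/negPn/negP => /grad_supp.
have [S0|/set0P S0] := eqVneq (supp u) set0.
  by exists 0 => // x; rewrite gz// S0.
have Hi i : exists b : R, 0 <= b /\ forall x, supp u x -> `|partial i u x| <= b.
  have cf : continuous (fun x => `|partial i u x|).
    by move=> x; apply: (@continuous_comp _ _ _ (partial i u) Num.norm);
      [exact: cdu|exact: norm_continuous].
  have [c _ cM] := compact_EVT_max S0 cs (continuous_subspaceT cf).
  by exists `|partial i u c|; split=> // x sx; apply: cM; rewrite inE.
have [b Hb] := choice Hi.
have b0 : 0 <= \sum_i b i by apply: sumr_ge0 => i _; case: (Hb i).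
exists (Num.sqrt N%:R * \sum_i b i); first by rewrite mulr_ge0 ?sqrtr_ge0.
move=> x; have [sx|/gz ->] := pselect (supp u x); last by rewrite mulr_ge0 ?sqrtr_ge0.
apply: enorm_le => // i; rewrite mxE.
have [_ /(_ x sx) H] := Hb i; apply: le_trans H _.
by rewrite (bigD1 i)//= lerDl sumr_ge0// => j _; case: (Hb j).
Qed.

Lemma powR_integral_grad_lt_pinfty (A : set 'rV[R]_N) (u : 'rV[R]_N -> R) (rho : R) : 0 <= rho ->
  Cc_smooth A u -> A `<=` box (fun=> `[- rho, rho]%classic) ->
  (\int[leb]_x (`|enorm (grad u x)| `^ p)%:E < +oo)%E.
Proof.
move=> rho0 cu AQ; have [B B0 HB] := Cc_smooth_grad_bounded cu.
have [su _ sA] := cu.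
have cdu i : continuous (partial i u) by have [] := su [:: i].
have mQ : measurable (box (fun=> `[- rho, rho]%classic) : set 'rV[R]_N).
  by apply: measurable_box => i; exact: measurable_itv.
apply: (@le_lt_trans _ _
  (\int[leb]_x (B `^ p * \1_(box (fun=> `[- rho, rho]%classic)) x)%:E)%E); last first.
  rewrite ge0_integral_scale ?powR_ge0//.
  have -> : (\int[leb]_x (\1_(box (fun=> `[- rho, rho]%classic)) x)%:E = ((2 * rho) ^+ N)%:E)%E.
    by rewrite -(lebesgue_cube_box N rho0) integral_indic// setIT.
  by rewrite -EFinM ltry.
apply: ge0_le_integralT.
- by apply/measurable_EFinP; exact: measurable_norm_grad.
- by apply/measurable_EFinP; apply: measurable_funM => //; exact: measurable_indic.
- by move=> x; rewrite lee_fin powR_ge0.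
- move=> x; rewrite lee_fin indicE; have [->|gx] := eqVneq (enorm (grad u x)) 0.
    by rewrite normr0 powR0 ?mulr_ge0 ?powR_ge0// gt_eqF// (lt_trans ltr01).
  rewrite mem_set ?mulr1; last exact/AQ/sA/grad_supp.
  have e0 : 0 <= enorm (grad u x) by rewrite sqrtr_ge0.
  by rewrite ger0_norm// ge0_ler_powR// ?nnegrE// ltW// (lt_trans ltr01).
Qed.

End lambda1_finite.

Section bounds.
Context (R : realType) (N : nat) (m : 'I_N) (hm : m.+1 = N).
Variables (l : R) (n : nat) (p s : R).
Hypothesis l0 : 0 < l.
Hypothesis p1 : 1 < p.
Hypothesis s0 : 0 < s.
Hypothesis sp1 : s < 1 / p.
Local Notation leb := (lebesgue_rV R N).
Local Notation r := (l * (n%:R + 1 / 2)).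

Let p0 : 0 < p := lt_trans ltr01 p1.
Let sp_gt0 : 0 < s * p. Proof. exact: mulr_gt0. Qed.
Let sp_lt1 : s * p < 1. Proof. by rewrite -ltr_pdivlMr. Qed.
Let r0 : 0 < r := r_gt0 n l0.

Let eps := r * eta n (s * p).
Let eps0 : 0 < eps. Proof. by rewrite mulr_gt0// eta_gt0. Qed.
Let u := @test R N m l n eps.

Let uA c : Cc_smooth (@dom R N l n) (fun x => c * u x).
Proof. exact: Cc_smooth_test. Qed.

Let mu : measurable_fun setT u.
Proof.
apply: continuous_measurable_rV; have := @smooth_expr_test R N m l n eps 1.
under eq_fun do rewrite mul1r.
exact: continuous_smooth_expr.
Qed.

(* Together with lambdas_dom_gt0 this excludes the junk values fine +oo = 0 and
   x / 0 = 0 from the ratio in the theorem. *)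
Lemma lambda1_dom_lt_pinfty : (lambda1 p (@dom R N l n) < +oo)%E.
Proof.
have [W uW HW] := powR_integral_test hm n l0 p1 sp_gt0 sp_lt1.
have W0 : 0 < W by apply: lt_le_trans HW; rewrite divr_gt0// exprn_gt0// divr_gt0.
apply: (@lambda1_lt_pinfty R N p p1 (@dom R N l n) u W uA mu W0 uW).
apply: (@powR_integral_grad_lt_pinfty R N p p1 _ _ r (ltW r0) (uA _)) => x Dx i.
by rewrite /= in_itv/= -ler_norml ltW//; exact: dom_cube.
Qed.

(** The factor 2 * 3^N is the inverse of the mass bound (r/3)^N / 2, up to r^N. *)
Definition lambdas_cst : R := 2 * 3 ^+ N * energy_cst N (s * p).

Lemma lambdas_dom_le :
  (lambdas s p (@dom R N l n) <= (lambdas_cst * r `^ (- (s * p)))%:E)%E.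
Proof.
have [W uW HW] := powR_integral_test hm n l0 p1 sp_gt0 sp_lt1.
have W1 : 0 < (r / 3) ^+ N / 2 by rewrite divr_gt0// exprn_gt0// divr_gt0.
have W0 : 0 < W by exact: lt_le_trans HW.
have E := energy_le hm n l0 p1 sp_gt0 sp_lt1.
apply: le_trans (lambdas_le p1 uA mu W0 uW E) _; rewrite lee_fin ler_pdivrMr//.
have c0 : 0 <= energy_cst N (s * p).
  have C0 := @shell_cst_ge0 R N (s * p) sp_gt0 sp_lt1.
  by rewrite /energy_cst addr_ge0// !mulr_ge0 ?powR_ge0 ?expR_ge0.
apply: (@le_trans _ _ (lambdas_cst * r `^ (- (s * p)) * ((r / 3) ^+ N / 2))); last first.
  by rewrite ler_wpM2l// !mulr_ge0 ?powR_ge0.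
rewrite /lambdas_cst expr_div_n; set a := 3 ^+ N; have a0 : a != 0 by rewrite expf_neq0.
suff -> (e x y : R) : 2 * a * e * x * (y / a / 2) = e * (y * x) by [].
by field.
Qed.

(** Integrate only over pairs with [x] in the domain and [y] in a box [Q] adjacent to the cube, of
    last coordinate between r and 3r. There v(y) = 0 and the kernel is bounded below, so the energy
    is at least a positive multiple of the unit mass of [v]. *)
Lemma lambdas_dom_gt0 : (0 < lambdas s p (@dom R N l n))%E.
Proof.
pose I (i : 'I_N) : set R := if i == m then `[2 * r - r, 2 * r + r]%classic else `[- r, r]%classic.
pose Q : set 'rV[R]_N := box I.
have mQ : measurable Q by apply: measurable_box => i; rewrite /I; case: ifPn => _; exact: measurable_itv.
have a0 : 0 <= N%:R + s * p by rewrite addr_ge0// ltW.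
have N0 : (0 < N)%N by rewrite -hm.
(* Each coordinate of [x - y] is at most 4r in absolute value, so [D] bounds the Euclidean
   distance. *)
pose D := Num.sqrt N%:R * (4 * r).
have D0 : 0 < D by rewrite mulr_gt0 ?sqrtr_gt0 ?ltr0n ?mulr_gt0.
pose K := (D `^ (N%:R + s * p))^-1.
have K0 : 0 < K by rewrite invr_gt0 powR_gt0.
pose V := 2 * r * (2 * r) ^+ N.-1.
have V0 : 0 < V by rewrite !mulr_gt0// exprn_gt0// mulr_gt0.
have vQ : leb Q = V%:E by rewrite /Q /I lebesgue_slab_box ?(ltW r0)//.
apply: (@lt_le_trans _ _ (K * V)%:E); first by rewrite lte_fin mulr_gt0.
apply: le_ereal_inf_tmp => _ [v [[sv cv vD] nv] <-].
have supD x : v x != 0 -> @dom R N l n x by move=> /neq0_supp; exact: vD.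
have := Lp_norm_poweR (lt0r_neq0 p0) supD; rewrite nv poweR_EFin powR1 => n1.
have mv : measurable_fun setT v.
  by apply: continuous_measurable_rV; have [] := sv [::].
rewrite gagliardo_poweR//.
pose f (z : 'rV[R]_N * 'rV[R]_N) : R := K * (`|v z.1| `^ p * \1_Q z.2).
have f0 z : 0 <= f z by rewrite /f !mulr_ge0 ?powR_ge0// ltW.
have mf : measurable_fun setT f.
  apply: measurable_funM => //; apply: measurable_funM.
    by apply: measurable_norm_powR; exact: (measurableT_comp mv measurable_fst).
  exact: (measurableT_comp (measurable_indic mQ) measurable_snd).
apply: (@le_trans _ _ (\int[leb \x leb]_z (f z)%:E)%E).
  rewrite fubini_tonelli1; last 2 first.
  - exact/measurable_EFinP.
  - by move=> z; rewrite lee_fin.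
  have inner x : fubini_F leb (EFin \o f) x = (K * V * `|v x| `^ p)%:E.
    rewrite /fubini_F /f/=.
    have -> : (\int[leb]_y (K * (`|v x| `^ p * \1_Q y))%:E =
        \int[leb]_y (K * `|v x| `^ p * \1_Q y)%:E)%E.
      by apply: eq_integral => y _; rewrite mulrA.
    have Kv : 0 <= K * `|v x| `^ p by rewrite mulr_ge0 ?powR_ge0// ltW.
    rewrite (ge0_integral_scale _ (measurable_indic mQ) _ Kv)//.
    have -> : (\int[leb]_y (\1_Q y)%:E = leb Q)%E by rewrite integral_indic// setIT.
    by rewrite vQ -EFinM mulrAC.
  under eq_integral do rewrite inner.
  rewrite ge0_integral_scale -?n1 ?mule1//.
  - exact: measurable_norm_powR.
  - by rewrite mulr_ge0// ltW.
apply: ge0_le_integralT.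
- exact/measurable_EFinP.
- apply/measurable_EFinP; apply: measurable_funM.
    apply: measurable_norm_powR; apply: measurable_funB.
      exact: (measurableT_comp mv measurable_fst).
    exact: (measurableT_comp mv measurable_snd).
  under eq_fun do rewrite -powRN.
  apply: (measurableT_comp (f := @powR R ^~ (- (N%:R + s * p)))); first exact: measurable_powR.
  exact: (measurableT_comp (@measurable_enorm R N) (@measurable_sub_rV R N)).
- by move=> z; rewrite lee_fin.
- move=> [x y]; rewrite lee_fin /f /=; rewrite indicE.
  have [yQ|_] := boolP (y \in Q); last by rewrite !mulr0 divr_ge0 ?powR_ge0.
  have [->|vx] := eqVneq (v x) 0.
    by rewrite normr0 powR0 ?gt_eqF// mul0r mulr0 divr_ge0 ?powR_ge0.
  have xr i := dom_cube l0 i (supD _ vx).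
  have /= yI i : I i (y ord0 i) by move: yQ; rewrite inE; apply.
  have ym : r <= y ord0 m <= 3 * r.
    have := yI m; rewrite /I eqxx /= in_itv/= => /andP[h1 h2]; apply/andP; split; lra.
  have yr i : - r <= y ord0 i <= 3 * r.
    have := yI i; rewrite /I; have r0' := r0; case: eqVneq => [->|_];
    rewrite /= in_itv/= => /andP[h1 h2];
    apply/andP; split; lra.
  have -> : v y = 0.
    apply/eqP/negPn/negP => /supD Dy; have := dom_cube l0 m Dy; case/andP: ym => h _.
    by rewrite ger0_norm ?(le_trans (ltW r0))// ltNge h.
  rewrite subr0 mulr1 mulrC ler_wpM2l ?powR_ge0//.
  have e0 : 0 < enorm (x - y).
    apply: lt_le_trans (norm_rV_le_enorm _); apply: lt_le_trans (le_norm_coord _ m).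
    rewrite !mxE normr_gt0; have := xr m; case/andP: ym => h _; rewrite ltr_norml => /andP[_ h2].
    by rewrite lt_eqF// subr_lt0 (lt_le_trans h2).
  rewrite /K lef_pV2 ?posrE ?powR_gt0// ge0_ler_powR ?nnegrE ?(ltW e0) ?(ltW D0)//.
  apply: enorm_le; first by rewrite mulr_ge0// ltW.
  move=> i; rewrite !mxE; have := xr i; rewrite ltr_norml => /andP[? ?].
  have /andP[? ?] := yr i; rewrite ler_norml; apply/andP; split; lra.
Qed.

End bounds.

(** * Volume, shape and diameter of the rescaled sets *)

Section perforated_cube_geometry.
Context (R : realType) (N : nat) (m : 'I_N) (hm : m.+1 = N).
Implicit Types (x : 'rV[R]_N) (z : 'rV[int]_N).
Local Notation leb := (lebesgue_rV R N).

Let N0 : (0 < N)%N. Proof. by rewrite -hm. Qed.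

(** The last side is written as a degenerate interval of radius 0 so that [lebesgue_sym_itv] yields
    the vanishing factor of the volume. *)
Lemma slit_at_box z : slit_at z = box (fun i => if i == m
  then `[(z ord0 i)%:~R - 0, (z ord0 i)%:~R + 0]%classic
  else `[(z ord0 i)%:~R - 1 / 4, (z ord0 i)%:~R + 1 / 4]%classic) :> set 'rV[R]_N.
Proof.
apply/seteqP; split=> [_ [w sw <-] i|x Hx].
  have := sw i; rewrite (last_eq hm) !mxE; case: ifPn => [_ ->|_ /andP[h1 h2]].
    by rewrite /= in_itv/= add0r subr0 addr0 lexx.
  by rewrite /= in_itv/=; apply/andP; split; lra.
exists (x - map_mx intr z); last by rewrite subrK.
move=> i; have := Hx i; rewrite (last_eq hm) !mxE.
case: ifPn => [_|_]; rewrite /= in_itv/=; last by move=> /andP[h1 h2]; apply/andP; split; lra.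
by rewrite subr0 addr0 => /le_anti ->; rewrite subrr.
Qed.

Lemma measurable_slit_at z : measurable (slit_at z : set 'rV[R]_N).
Proof.
by rewrite slit_at_box; apply: measurable_box => i; case: ifPn => _; exact: measurable_itv.
Qed.

Lemma lebesgue_slit_at z : leb (slit_at z) = 0%E.
Proof.
rewrite slit_at_box lebesgue_rV_box; last by move=> i; case: ifPn => _; exact: measurable_itv.
by rewrite (bigD1 m)//= eqxx lebesgue_sym_itv// mulr0 mul0e.
Qed.

(** The slits are null and the cube has side 2n+1; hence the normalizing factor is exactly
    1/(2n+1). *)
Lemma lebesgue_Omega_tilde n : leb (Omega_tilde R N n) = ((2 * n + 1)%:R ^+ N)%:E.
Proof.
have cubeE : cube (n%:R + 1 / 2) =
    box (fun=> `]- (n%:R + 1 / 2), (n%:R + 1 / 2)[%classic) :> set 'rV[R]_N.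
  by apply/seteqP; split=> x Hx i; have := Hx i; rewrite /= in_itv.
have mc : measurable (cube (n%:R + 1 / 2) : set 'rV[R]_N).
  by rewrite cubeE; apply: measurable_box => i; exact: measurable_itv.
have lc : leb (cube (n%:R + 1 / 2)) = ((2 * n + 1)%:R ^+ N)%:E.
  rewrite cubeE lebesgue_rV_box; last by move=> i; exact: measurable_itv.
  rewrite (eq_bigr (fun=> ((2 * n + 1)%:R : R)%:E)) ?prodEFin ?prodr_const ?card_ord//.
  move=> i _; rewrite lebesgue_measure_itv/= lte_fin.
  have n0 : 0 <= n%:R :> R by [].
  rewrite ifT; last by lra.
  by rewrite -EFinD natrD natrM; congr EFin; field.
pose U := \bigcup_(z in Zbox n) slit_at z : set 'rV[R]_N.
have mU : measurable U.
  rewrite /U bigcup_mkcond; apply: countable_bigcupT_measurable; first exact: countableP.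
  by move=> z; case: ifPn => _; [exact: measurable_slit_at|exact: measurable0].
have U0 : leb U = 0%E.
  apply/(negligibleP _ mU).
  pose F k : set 'rV[R]_N := if unpickle k is Some z then slit_at z else set0.
  apply: (@negligibleS _ _ _ _ (\bigcup_k F k)).
    by move=> x [z _ xz]; exists (pickle z) => //; rewrite /F pickleK.
  apply: negligible_bigcup => k; rewrite /F; case: (unpickle k) => [z|]; last exact: negligible_set0.
  by apply/negligibleP; [exact: measurable_slit_at|exact: lebesgue_slit_at].
have UI : leb (cube (n%:R + 1 / 2) `&` U) = 0%E.
  apply: (@subset_measure0 _ _ _ _ _ U _ mU _ U0); [exact: measurableI|exact: subIsetr].
have cfin : (leb (cube (n%:R + 1 / 2)) < +oo)%E by rewrite [ltLHS]lc ltry.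
apply: etrans (measureD mc mU cfin) _.
exact: etrans (f_equal2 (fun a b => a - b)%E lc UI) (sube0 _).
Qed.

Lemma Omega_dom n : Omega R N n = @dom R N (2 * n + 1)%:R^-1 n.
Proof.
rewrite /Omega /dom; congr dilate; rewrite [X in fine X]lebesgue_Omega_tilde/=.
rewrite -powR_mulrn// -powRrM mulrN mulrA mulr1 mulfV ?pnatr_eq0 -?lt0n//.
by rewrite powR_inv1.
Qed.

Lemma Omega_tilde_dom n : Omega_tilde R N n = @dom R N 1 n.
Proof.
apply/seteqP; split=> x; rewrite /dom.
  by move=> Ox; apply/(dilateP _ _ (oner_neq0 _)); rewrite invr1 scale1r.
by move=> /(dilateP _ _ (oner_neq0 _)); rewrite invr1 scale1r.
Qed.

Lemma OmegaE n : Omega R N n = cube (1 / 2) `\`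
  \bigcup_(z in Zbox n) dilate (2 * n + 1)%:R^-1 (slit_at z).
Proof.
rewrite Omega_dom; have c0 : (2 * n + 1)%:R != 0 :> R by rewrite pnatr_eq0 addn1.
have c1 : (2 * n + 1)%:R^-1 != 0 :> R by rewrite invr_eq0.
have cp : 0 < (2 * n + 1)%:R :> R by rewrite ltr0n addn1.
have cE : (2 * n + 1)%:R = 2 * n%:R + 1 :> R by rewrite natrD natrM.
have cubeE x : cube (n%:R + 1 / 2) ((2 * n + 1)%:R *: x) <-> cube (1 / 2) x.
  have H i : (- (n%:R + 1 / 2) < ((2 * n + 1)%:R *: x) ord0 i < n%:R + 1 / 2) =
      (- (1 / 2) < x ord0 i < 1 / 2).
    rewrite mxE; have -> : n%:R + 1 / 2 = (2 * n + 1)%:R * (1 / 2) :> R by rewrite cE; field.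
    by rewrite -mulrN !ltr_pM2l.
  by split=> Hx i; have := Hx i; rewrite H.
apply/seteqP; split=> x; rewrite /dom.
  move=> /(dilateP _ _ c1)[]; rewrite invrK => /cubeE Hc nU; split=> // -[z zn /(dilateP _ _ c1) xz].
  by apply: nU; exists z => //; move: xz; rewrite invrK.
move=> [/cubeE Hc nU]; apply/(dilateP _ _ c1); rewrite invrK; split=> // -[z zn xz].
by apply: nU; exists z => //; apply/(dilateP _ _ c1); rewrite invrK.
Qed.

Lemma enorm_const (c : R) : enorm (const_mx c : 'rV[R]_N) = Num.sqrt N%:R * `|c|.
Proof.
rewrite /enorm (eq_bigr (fun=> c ^+ 2)); last by move=> i _; rewrite mxE.
by rewrite sumr_const card_ord -[X in Num.sqrt X]mulr_natl sqrtrM// sqrtr_sqr.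
Qed.

Lemma diam_Omega n : diam (Omega R N n) = (Num.sqrt N%:R)%:E.
Proof.
have l0 : 0 < (2 * n + 1)%:R^-1 :> R by rewrite invr_gt0 ltr0n addn1.
set l : R := (2 * n + 1)%:R^-1 in l0.
have lE : l * (n%:R + 1 / 2) = 1 / 2.
  have n0 : 0 <= n%:R :> R by [].
  by rewrite /l natrD natrM; field; lra.
rewrite Omega_dom -/l; apply/eqP; rewrite eq_le; apply/andP; split.
  apply: ge_ereal_sup => _ [x Dx [y Dy <-]]; rewrite lee_fin -[leRHS]mulr1.
  apply: enorm_le => // i; rewrite !mxE.
  have := dom_cube l0 i Dx; have := dom_cube l0 i Dy; rewrite lE !ltr_norml => /andP[? ?] /andP[? ?].
  by rewrite ler_norml; apply/andP; split; lra.
apply/lee_addgt0Pr => e e0.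
have sN : 0 < Num.sqrt N%:R :> R by rewrite sqrtr_gt0 ltr0n.
(* The corners are not in the open set, so points of the diagonal at depth [d] are used. The bound
   l/4 keeps them beyond the outermost hyperplanes, at height 1/2 - l/2; the other bound keeps the
   loss 2 d sqrt(N) below [e]. *)
pose d := Num.min (l / 4) (e / (2 * Num.sqrt N%:R)).
have d0 : 0 < d by rewrite lt_min !divr_gt0 ?mulr_gt0.
have dl : d <= l / 4 by rewrite ge_min lexx.
have de : 2 * d * Num.sqrt N%:R <= e.
  have : d <= e / (2 * Num.sqrt N%:R) by rewrite ge_min lexx orbT.
  by rewrite ler_pdivlMr ?mulr_gt0// mulrA (mulrC d 2).
have l1 : l <= 1 by rewrite /l invf_le1 ?ler1n ?ltr0n addn1.
have mem c : `|c| = 1 / 2 - d -> @dom R N l n (const_mx c).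
  move=> cE; apply: (mem_dom hm l0) => [i|k kn]; first by rewrite mxE cE lE; lra.
  rewrite mxE; apply/negP => /eqP ck; move: cE; rewrite ck normrM gtr0_norm//.
  have : `|k%:~R| <= n%:R :> R by rewrite -intr_norm -natr_absz ler_nat.
  rewrite -(ler_pM2l l0) => h; have := lE; rewrite mulrDr; lra.
apply: (@le_trans _ _
  ((enorm (const_mx (1 / 2 - d) - const_mx (- (1 / 2 - d)) : 'rV[R]_N))%:E + e%:E)%E).
  have -> : const_mx (1 / 2 - d) - const_mx (- (1 / 2 - d)) = const_mx (1 - 2 * d) :> 'rV[R]_N.
    by apply/rowP => i; rewrite !mxE; field.
  rewrite enorm_const -EFinD lee_fin ger0_norm; last by lra.
  by rewrite mulrBr mulr1; lra.
rewrite leeD2r//; apply: ereal_sup_ubound; exists (const_mx (1 / 2 - d)).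
  by apply: mem; rewrite ger0_norm//; lra.
exists (const_mx (- (1 / 2 - d))) => //.
by apply: mem; rewrite normrN ger0_norm//; lra.
Qed.

End perforated_cube_geometry.

(** * Divergence of the ratio *)

Section limits.
Context (R : realType).

Lemma cvgy_powR (T : Type) (F : set_system T) {FF : Filter F} (f : T -> R) (a : R) : 0 < a ->
  f x @[x --> F] --> +oo -> f x `^ a @[x --> F] --> +oo.
Proof.
move=> a0 /cvgryPge fy; apply/cvgryPge => A.
have := fy (`|A| `^ a^-1); apply: filterS => x Ax.
apply: (le_trans (ler_norm A)).
have fx : 0 <= f x by apply: le_trans Ax; exact: powR_ge0.
rewrite -[leLHS](powRr1 (normr_ge0 A)) -[X in _ `^ X](mulVf (lt0r_neq0 a0)) powRrM.
by apply: ge0_ler_powR; rewrite ?nnegrE ?powR_ge0// ltW.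
Qed.

Lemma cvg_ratioy (f g : nat -> R) (a b p s : R) : 0 < a -> 0 < b -> 0 < p -> 0 < s ->
  (forall n, a * n%:R `^ p <= f n) -> (forall n, 0 < g n <= b) ->
  f n `^ s / g n @[n --> \oo] --> +oo.
Proof.
move=> a0 b0 p0 s0 Hf Hg; apply/cvgryPge => A.
have ps0 : 0 < p * s by rewrite mulr_gt0.
have FF : Filter \oo by exact: filter_filter.
have := (cvgryPge _).1 (cvgy_powR ps0 (@cvgr_idn R)) (A * b / a `^ s).
move=> /(_ FF FF); apply: filterS => n; rewrite ler_pdivrMr ?powR_gt0// => An.
have /andP[g0 gb] := Hg n.
apply: (@le_trans _ _ ((a * n%:R `^ p) `^ s / b)).
  by rewrite ler_pdivlMr// (powRM s (ltW a0) (powR_ge0 _ _)) -powRrM [leRHS]mulrC.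
have an : 0 <= a * n%:R `^ p by rewrite mulr_ge0 ?powR_ge0// ltW.
apply: ler_pM; rewrite ?powR_ge0 ?invr_ge0 ?(ltW b0)//.
  by apply: ge0_ler_powR; rewrite ?nnegrE ?(ltW s0)// (le_trans an).
by rewrite lef_pV2 ?posrE.
Qed.

End limits.

Theorem lemmaA1 (R : realType) (N : nat) (p : R) (hN : (1 <= N)%N)
    (hp : 1 < p) :
  exists C : R, 0 < C /\
  forall s : R, 0 < s < 1 -> s < 1 / p ->
    [/\ (forall n : nat, (C%:E <= lambda1 p (Omega_tilde R N n))%E),
        lambdas s p (Omega_tilde R N n) @[n --> \oo] --> 0%E,
        (forall n : nat, Omega R N n =
          cube (1 / 2) `\`
            \bigcup_(z in Zbox n) dilate (2 * n + 1)%:R^-1 (slit_at z)),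
        (forall n : nat, diam (Omega R N n) = (Num.sqrt N%:R)%:E) &
        fine (lambda1 p (Omega R N n)) `^ s / fine (lambdas s p (Omega R N n))
          @[n --> \oo] --> +oo].
Proof.
have mN : (N.-1 < N)%N by rewrite prednK.
pose m : 'I_N := Ordinal mN.
have hm : m.+1 = N by rewrite /= prednK.
have p0 : 0 < p := lt_trans ltr01 hp.
have P0 : 0 < poincare_cst p N.-1 := poincare_cst_gt0 p N.-1.
(* The constant is fixed before [s] is introduced, so it depends on [N] and [p] only. *)
exists (poincare_cst p N.-1)^-1; split; first by rewrite invr_gt0.
move=> s /andP[s0 _] sp1; have sp0 : 0 < s * p by rewrite mulr_gt0.
pose M := lambdas_cst N p s.
split=> [n||n|n|].
- by have := lambda1_dom_ge hm hp n ltr01; rewrite powR1 mulr1 Omega_tilde_dom.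
(* The case l = 1, where r = n + 1/2 tends to infinity. *)
- pose h n : \bar R := (M * (1 * (n%:R + 1 / 2)) `^ (- (s * p)))%:E.
  apply: (@squeeze_cvge _ _ _ _ (fun=> 0%E) _ h).
  + apply: nearW => n; rewrite Omega_tilde_dom (lambdas_dom_le hm n ltr01 hp s0 sp1) andbT.
    exact: ltW (lambdas_dom_gt0 hm n ltr01 hp s0).
  + exact: cvg_cst.
  + rewrite /h; apply: cvg_EFin; first exact: nearW.
    rewrite -[X in _ --> X](mulr0 M); apply: cvgMr.
    under eq_fun do rewrite mul1r powRN.
    apply/(@gtr0_cvgV0 R nat \oo _ (fun n => (n%:R + 1 / 2) `^ (s * p))).
      by apply: nearW => n; rewrite powR_gt0// ltr_wpDl.
    apply: cvgy_powR => //; apply: ger_cvgy (@cvgr_idn R); apply: nearW => n.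
    by rewrite lerDl.
- exact: OmegaE hm n.
- exact: diam_Omega hm n.
(* The case l = 1/(2n+1), where r = 1/2 and the upper bound no longer depends on n. *)
- pose b := M * (1 / 2) `^ (- (s * p)).
  have l0 n : 0 < (2 * n + 1)%:R^-1 :> R by rewrite invr_gt0 ltr0n addn1.
  have lE n : (2 * n + 1)%:R^-1 * (n%:R + 1 / 2) = 1 / 2 :> R.
    have n0 : 0 <= n%:R :> R by [].
    by rewrite natrD natrM; field; lra.
  have Hs n : (0 < lambdas s p (Omega R N n) <= b%:E)%E.
    rewrite (Omega_dom R hm) (lambdas_dom_gt0 hm n (l0 n) hp s0)/=.
    by have := lambdas_dom_le hm n (l0 n) hp s0 sp1; rewrite lE.
  have b0 : 0 < b.
    by rewrite -lte_fin; have /andP[] := Hs 0%N; exact: lt_le_trans.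
  (* The lower bound C (2n+1)^p is weakened to C n^p, which suffices for divergence. *)
  apply: (@cvg_ratioy R _ _ (poincare_cst p N.-1)^-1 b p s) => // [|n|n]; first by rewrite invr_gt0.
    rewrite (Omega_dom R hm).
    have H := lambda1_dom_ge hm hp n (l0 n).
    have F := lambda1_dom_lt_pinfty hm n (l0 n) hp s0 sp1.
    have fn : lambda1 p (@dom R N (2 * n + 1)%:R^-1 n) \is a fin_num.
      rewrite fin_numE; apply/andP; split; last by rewrite lt_eqF.
      by rewrite gt_eqF// (lt_le_trans _ H)// ltNyr.
    rewrite -lee_fin (fineK fn); apply: le_trans H; rewrite lee_fin ler_pM2l ?invr_gt0//.
    rewrite -(powR_inv1 (ler0n R (2 * n + 1))) -powRrM mulN1r opprK.
    apply: (@ge0_ler_powR R p (ltW p0)); rewrite ?nnegrE//.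
    by rewrite ler_nat; lia.
  have /andP[h1 h2] := Hs n.
  have fn : lambdas s p (Omega R N n) \is a fin_num.
    by rewrite ge0_fin_numE ?(ltW h1)// (le_lt_trans h2)// ltry.
  by rewrite -!lte_fin -lee_fin fineK// h1.
Qed.
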